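(* Let $w$ be a graphon satisfying (A1) with constant $K$. Then for every $N\in\mathbb{N}$, $$\|\mathbb{L}_N-\mathbb{L}\|_{op}\le \frac{4K}{N}.$$ Moreover, let $\tau\in[0,1)$ and $\rho_N=N^{-\tau}$, and let $G^{(N)}\sim\rho_N w$. For every $\varepsilon\in(0,1)$ and every $N\ge N_1(w,\tau,\varepsilon)$, $$\mathbb{P}\Big(\|\rho_N^{-1}\widehat{\mathbb{L}}_N-\mathbb{L}\|_{op}\le 4\sqrt{\tfrac{\log(4N/\varepsilon)}{\rho_N N}}+\tfrac{4K}{N}\Big)\ge 1-\varepsilon,$$ and for every $\gamma>1$ and every $N\ge N_1'(w,\tau,\gamma)$ the same inequality holds with $\varepsilon$ replaced by $\varepsilon_\gamma(N)$ (both in the bound and in the probability).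
   Context: A graphon is a measurable symmetric function $w:[0,1]^2\to[0,1]$, with degree $d(x)=\int_0^1 w(x,y)\,dy$ and $d_{\mathrm{MAX}}=\max_x d(x)$. Assumption (A1): there is $K>0$ with $|w(x,y)-w(x',y')|\le K(|x-x'|+|y-y'|)$. For a graphon $u$, its graphon-Laplacian is the operator on $L^2([0,1])$ given by $f\mapsto \int_0^1 u(x,y)(f(x)-f(y))\,dy$; $\mathbb{L}$ is the one for $w$. $\|\cdot\|_{op}$ is the operator norm on $L^2([0,1])$. Random graph model $G^{(N)}\sim\rho_N w$: vertices $v_i=i/N$, $i\in[N]$; for each $i<j$ independently, the edge $\{i,j\}$ is present with probability $\rho_N w(i/N,j/N)$; $\widehat P^{(N)}$ is the (symmetric, zero-diagonal) adjacency matrix and $P^{(N)}_{ij}=w(i/N,j/N)$. With $\mathcal{I}_1=[0,1/N]$, $\mathcal{I}_i=((i-1)/N,i/N]$ for $i\ge2$, set $w_N(x,y)=\sum_{i,j}P^{(N)}_{ij}\mathbf{1}_{\mathcal{I}_i}(x)\mathbf{1}_{\mathcal{I}_j}(y)$ and $\widehat w_N(x,y)=\sum_{i,j}\widehat P^{(N)}_{ij}\mathbf{1}_{\mathcal{I}_i}(x)\mathbf{1}_{\mathcal{I}_j}(y)$; $\mathbb{L}_N,\widehat{\mathbb{L}}_N$ are the graphon-Laplacians of $w_N,\widehat w_N$. Let $\varepsilon_\gamma(N)=\exp(-(\log N)^\gamma)$. $N_1(w,\tau,\varepsilon)=\min\{n: N\ge n\Rightarrow d_{\mathrm{MAX}}\ge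 \frac{4\log(4N/\varepsilon)}{9\rho_N N}+\frac{2K}{N}\}$ and $N_1'(w,\tau,\gamma)$ is defined the same way with $\varepsilon$ replaced by $\varepsilon_\gamma(N)$. *)

(* Defs.v *)
From HB Require Import structures.
From mathcomp Require Import all_boot all_order all_algebra.
From mathcomp Require Import all_classical all_reals all_analysis.
Set Implicit Arguments. Unset Strict Implicit. Unset Printing Implicit Defensive.
Import Order.TTheory GRing.Theory Num.Theory.
Local Open Scope classical_set_scope.
Local Open Scope ring_scope.

Section GraphonDefs.
Variable R : realType.
Local Notation mu := (@lebesgue_measure R).

Definition I01 : set R := `[0%R, 1%R]%classic.

Definition is_graphon (w : R -> R -> R) : Prop :=
  (forall x y, x \in `[0%R, 1%R] -> y \in `[0%R, 1%R] -> 0 <= w x y <= 1) /\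
  (forall x y, x \in `[0%R, 1%R] -> y \in `[0%R, 1%R] -> w x y = w y x).

Definition lipschitzA1 (w : R -> R -> R) (K : R) : Prop :=
  0 < K /\
  forall x y x' y', x \in `[0%R, 1%R] -> y \in `[0%R, 1%R] ->
    x' \in `[0%R, 1%R] -> y' \in `[0%R, 1%R] ->
    `|w x y - w x' y'| <= K * (`|x - x'| + `|y - y'|).

Definition degree (w : R -> R -> R) (x : R) : R := Rintegral mu I01 (w x).
Definition dMAX (w : R -> R -> R) : R := sup [set degree w x | x in I01].

Definition glaplacian (u : R -> R -> R) (f : R -> R) (x : R) : R :=
  Rintegral mu I01 (fun y => u x y * (f x - f y)).

Definition l2norm (g : R -> R) : \bar R :=
  poweR (\int[mu]_(x in I01) ((g x) ^+ 2)%:E)%E (2^-1).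

Definition opnorm (T : (R -> R) -> (R -> R)) : \bar R :=
  ereal_sup [set l2norm (T f) | f in
     [set f : R -> R | measurable_fun I01 f /\ (l2norm f <= 1)%E]].

(* the intervals I_i, i = k+1 for k : 'I_N *)
Definition cell (N : nat) (k : nat) : interval R :=
  if k == 0%N then `[0%R, (N%:R)^-1]
  else `]k%:R / N%:R, k.+1%:R / N%:R].

Definition stepgraphon (N : nat) (P : 'M[R]_N) (x y : R) : R :=
  \sum_(i < N) \sum_(j < N)
     P i j * (x \in cell N i)%:R * (y \in cell N j)%:R.

(* P^{(N)}_{ij} = w(i/N, j/N), vertices indexed 1..N *)
Definition Pmat (w : R -> R -> R) (N : nat) : 'M[R]_N :=
  \matrix_(i < N, j < N) w (i.+1%:R / N%:R) (j.+1%:R / N%:R).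

Definition wN (w : R -> R -> R) (N : nat) : R -> R -> R :=
  stepgraphon (Pmat w N).

(* sample space of G^(N): edge sets E, encoded as sets of pairs (i,j), i<j *)
Definition upper_pairs (N : nat) : {set 'I_N * 'I_N} :=
  [set p : 'I_N * 'I_N | (p.1 < p.2)%N].

Definition adjacency (N : nat) (E : {set 'I_N * 'I_N}) : 'M[R]_N :=
  \matrix_(i < N, j < N) (((i, j) \in E) || ((j, i) \in E))%:R.

Definition what_N (N : nat) (E : {set 'I_N * 'I_N}) : R -> R -> R :=
  stepgraphon (adjacency E).

(* probability of E under G^(N) ~ rho w: independent edges {i,j}, i<j,
   present with probability rho * w(i/N, j/N) *)
Definition edge_weight (w : R -> R -> R) (rho : R) (N : nat)
    (E : {set 'I_N * 'I_N}) : R :=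
  \prod_(p in upper_pairs N)
     (if p \in E then rho * Pmat w N p.1 p.2 else 1 - rho * Pmat w N p.1 p.2).

Definition prob_graph (w : R -> R -> R) (rho : R) (N : nat)
    (A : {set 'I_N * 'I_N} -> Prop) : R :=
  \sum_(E : {set 'I_N * 'I_N} | E \subset upper_pairs N)
     edge_weight w rho E * (`[< A E >])%:R.

Definition rhoN (tau : R) (N : nat) : R := powR (N%:R) (- tau).

Definition eps_gamma (gamma : R) (N : nat) : R :=
  expR (- powR (ln (N%:R)) gamma).

Definition N1cond (w : R -> R -> R) (K tau : R) (eps : nat -> R) (M : nat)
  : Prop :=
  4 * ln (4 * M%:R / eps M) / (9 * rhoN tau M * M%:R) + 2 * K / M%:R
    <= dMAX w.

(* the set whose minimum is N_1; "N >= N_1" means N >= min of this set *)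
Definition N1set (w : R -> R -> R) (K tau : R) (eps : nat -> R) : set nat :=
  [set n | forall M, (n <= M)%N -> N1cond w K tau eps M].

Definition geN1 (w : R -> R -> R) (K tau : R) (eps : nat -> R) (N : nat)
  : Prop := exists2 n, N1set w K tau eps n & (n <= N)%N.

Definition conc_event (w : R -> R -> R) (rho bound : R) (N : nat)
    (E : {set 'I_N * 'I_N}) : Prop :=
  (opnorm (fun f x => (rho^-1 * glaplacian (what_N E) f x - glaplacian w f x)%R)
     <= bound%:E)%E.

End GraphonDefs.

Arguments prob_graph {R} w rho N A.
Arguments conc_event {R} w rho bound N E.
Arguments edge_weight {R} w rho {N} E.

(* Main.v *)
Require Import Defs.
From HB Require Import structures.
From mathcomp Require Import all_boot all_order all_algebra.
From mathcomp Require Import all_classical all_reals all_analysis.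
From mathcomp Require Import measurable_realfun.
From mathcomp Require Import ring lra.
Import Order.TTheory GRing.Theory Num.Theory.
Import numFieldNormedType.Exports.
Local Open Scope ring_scope.

(** Write [X] for the adjacency matrix centred off the diagonal, [D] for the
    diagonal of its row sums, [s = rho N] and [L = ln (4 N / eps)]. In the
    expansion of [E tr X^r] a walk contributes only if it uses no edge exactly
    once, and then at most [rho] per distinct edge. Exposing a walk step by step,
    each step takes one of at most [N] new edges or an edge used before, so
    [E tr X^r] is at most [N] times the [r]-th central moment of a Poisson
    variable of parameter [s]; the same holds, without the factor [N], for each
    row sum. Summing the even moments into [cosh] gives
    [P (|X| > t) <= 2 N exp (s (e^y - 1 - y) - y t)], and likewise for [D]. With
    [y = sqrt (L / s)], which is at most [3/2] since the degree condition and
    [dMAX <= 1] give [L <= 9/4 s], and [t = 2 s y], each probability is at most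
    [2 N e^(-L) = eps / 2] because [e^y <= 1 + y + y^2].

    The diagonal of [Pmat w N] is not in [X]. It is harmless: on cell
    means the graphon-Laplacian of the step kernel is the discrete Laplacian, where
    the diagonal cancels, and on the orthogonal mean-zero parts it only shifts the
    multiplier by [rho <= t]. The passage from the step graphon to [w] costs
    [4 K / N] by the Lipschitz condition. *)

(** * Moment recursion *)

Section Exponential.
Set Implicit Arguments.
Unset Strict Implicit.
Variable R : realType.
Implicit Types (f df : R -> R) (x y s th : R).

Lemma ge0_is_derive_le f df :
  (forall x, is_derive x 1 f (df x)) -> (forall x, 0 <= x -> 0 <= df x) ->
  forall x, 0 <= x -> f 0 <= f x.
Proof.
move=> fdf df0 x x0; rewrite -subr_ge0.
have [|c] := MVT_segment x0 (fun y _ => fdf y).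
  apply: derivable_within_continuous => y _.
  exact: ex_derive.
rewrite in_itv/= => /andP[c0 _] ->.
by rewrite mulr_ge0 ?df0 ?subr0.
Qed.

Lemma expR_quadratic_ge x : 0 <= x -> 1 + x + x ^+ 2 / 2 <= expR x.
Proof.
move=> x0.
pose f y : R := expR y - (1 + y + y ^+ 2 / 2).
have := @ge0_is_derive_le f (fun y => expR y - (1 + y)) _ _ x x0.
rewrite /f expR0 => H; rewrite -subr_ge0; apply: le_trans (H _ _).
- by rewrite addr0 expr0n/= mul0r addr0 subrr.
- by move=> y; apply: is_derive_eq; rewrite /GRing.scale/=; field.
- by move=> y y0; rewrite subr_ge0 expR_ge1Dx.
Qed.

(** It bounds the Poisson exponent [e^y - 1 - y] by [y^2]; the range extends to [3/2], the bound on
    [y] that the degree condition yields. *)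
Lemma expR_quadratic_le y : 0 <= y <= 3 / 2 -> expR y <= 1 + y + y ^+ 2.
Proof.
move=> /andP[y0 y32].
(* the [2/1] Pade approximant of the exponential is an upper bound *)
have pade : (1 - y / 3) * expR y <= 1 + 2 / 3 * y + y ^+ 2 / 6.
  pose f z : R := expR (- z) * (1 + 2 / 3 * z + z ^+ 2 / 6) + z / 3.
  have dexpN (z : R) : is_derive z (1 : R) (fun z : R => expR (- z)) (- expR (- z)).
    have -> : (fun z : R => expR (- z)) = expR \o -%R by [].
    by apply: is_derive_eq; rewrite /GRing.scale/= ?mulrN1 ?mulN1r.
  have := @ge0_is_derive_le f
    (fun z => (1 - expR (- z) * (1 + z + z ^+ 2 / 2)) / 3) _ _ y y0.
  rewrite /f oppr0 expR0 => H.
  have {}H : 1 <= expR (- y) * (1 + 2 / 3 * y + y ^+ 2 / 6) + y / 3.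
    apply: le_trans (H _ _).
    - by rewrite !(mulr0, mul0r, expr0n, addr0)/= mulr1.
    - by move=> z; apply: is_derive_eq; rewrite /GRing.scale/=; field.
    - move=> z z0; rewrite divr_ge0// subr_ge0 expRN.
      by rewrite ler_pdivrMl ?expR_gt0// mulr1 expR_quadratic_ge.
  move: H; rewrite -lerBlDr expRN -(ler_pM2r (expR_gt0 y)).
  by rewrite mulrAC mulVf ?mul1r ?gt_eqF ?expR_gt0.
have h : (1 - y / 3) * expR y <= (1 - y / 3) * (1 + y + y ^+ 2).
  apply: le_trans pade _; rewrite -subr_ge0.
  (* Here [y <= 3/2] enters: it makes the last factor nonnegative. *)
  have -> : (1 - y / 3) * (1 + y + y ^+ 2) - (1 + 2 / 3 * y + y ^+ 2 / 6)
     = y ^+ 2 * (1 / 2 - y / 3) by field.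
  by rewrite mulr_ge0 ?sqr_ge0//; lra.
by rewrite ler_pM2l in h; last lra.
Qed.

End Exponential.

Section BlockCount.
Set Implicit Arguments.
Unset Strict Implicit.
Variables (R : realType) (n rho : R).
Hypotheses (n0 : 0 <= n) (rho0 : 0 <= rho).
Implicit Types th : R.

(* Weighted number of ways to continue for [r] steps a walk that has so far used
   [a] edges once and [b] edges at least twice, if each step takes one of at
   most [n] new edges or one of the old edges; an edge weighs [rho], and a walk
   counts only if it ends up using no edge exactly once. *)
Fixpoint walk_count (r a b : nat) : R :=
  if r is r'.+1 then
    n * walk_count r' a.+1 b + a%:R * walk_count r' a.-1 b.+1
      + b%:R * walk_count r' a b
  else (a == 0)%:R * rho ^+ b.

Lemma walk_count_ge0 r a b : 0 <= walk_count r a b.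
Proof.
elim: r a b => [|r IH] a b /=; first by rewrite mulr_ge0 ?exprn_ge0.
by rewrite !addr_ge0 ?mulr_ge0.
Qed.

(** The moment generating function of a centred Poisson variable of parameter [n * rho]. *)
Let phi th : R := expR (n * rho * (expR th - 1 - th)).

(** Closed form of the exponential generating function of [walk_count r a b] in [r]: an edge used
    once must recur, giving [e^th - 1]; an edge used at least twice may recur freely, giving [e^th];
    the new edges give [phi]. *)
Let egf a b th : R := rho ^+ (a + b) * ((expR th - 1) ^+ a * expR th ^+ b * phi th).

Let degf a b th : R :=
  n * egf a.+1 b th + a%:R * egf a.-1 b.+1 th + b%:R * egf a b th.

Let egf_derive a b th : is_derive th 1 (egf a b) (degf a b th).
Proof.
have d1 : is_derive th (1 : R) (fun t => (expR t - 1) ^+ a)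
   (a%:R * (expR th - 1) ^+ a.-1 * expR th).
  pose g t : R := expR t - 1.
  have dg : is_derive th (1 : R) g (expR th) by apply: is_derive_eq; rewrite subr0.
  have -> : (fun t => (expR t - 1) ^+ a) = g ^+ a by apply/funext => t; rewrite fctE.
  by apply: is_derive_eq.
have d2 : is_derive th (1 : R) (fun t => expR t ^+ b)
   (b%:R * expR th ^+ b.-1 * expR th).
  have -> : (fun t => expR t ^+ b) = (expR : R -> R) ^+ b by apply/funext => t; rewrite fctE.
  by apply: is_derive_eq.
rewrite /degf /egf; apply: is_derive_eq; rewrite /GRing.scale/=.
(* At [a = 0] or [b = 0] the truncated predecessors are harmless, as their terms carry the factor
   [a%:R] or [b%:R]. *)
by case: a b {d1 d2} => [|a] [|b] /=;
  rewrite ?(addnS, addSn, addn0, add0n, exprS, expr0) -/(phi th); ring.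
Qed.

(** Induction on the number of terms: the gap between [egf] and a partial sum vanishes at [0], and
    its derivative is the combination, given by the recursion, of gaps with one term fewer. The
    recursion shifts [a] and [b], so they stay general. *)
Lemma sum_walk_count_le m a b th : 0 <= th ->
  \sum_(r < m) th ^+ r / r`!%:R * walk_count r a b
    <= rho ^+ (a + b) * ((expR th - 1) ^+ a * expR th ^+ b
         * expR (n * rho * (expR th - 1 - th))).
Proof.
rewrite -/(egf a b th).
elim: m a b th => [|m IH] a b th th0.
  rewrite big_ord0 /egf /phi !mulr_ge0 ?exprn_ge0 ?expR_ge0// subr_ge0.
  by rewrite -expR0 ler_expR.
pose T k a b t : R := \sum_(r < k) t ^+ r / r`!%:R * walk_count r a b.
pose f t : R := egf a b t - T m.+1 a b t.
pose df t : R := degf a b t -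
  (n * T m a.+1 b t + a%:R * T m a.-1 b.+1 t + b%:R * T m a b t).
have dT (t : R) : is_derive t (1 : R) (T m.+1 a b)
  (n * T m a.+1 b t + a%:R * T m a.-1 b.+1 t + b%:R * T m a b t).
  have -> : T m.+1 a b = \sum_(r < m.+1) (fun t => t ^+ r / r`!%:R * walk_count r a b).
    by apply/funext => u; rewrite fct_sumE.
  have dmono r : is_derive t (1 : R) (fun t => t ^+ r / r`!%:R * walk_count r a b)
      (r%:R * t ^+ r.-1 / r`!%:R * walk_count r a b).
    have -> : (fun t => t ^+ r / r`!%:R * walk_count r a b)
        = (walk_count r a b / r`!%:R) \*: (id : R -> R) ^+ r.
      by apply/funext => u; rewrite /= fctE /GRing.scale/=; ring.
    by apply: is_derive_eq; rewrite /GRing.scale/=; ring.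
  have D := is_derive_sum (fun r : 'I_m.+1 => dmono r).
  apply: (is_derive_eq D).
  rewrite big_ord_recl /= /GRing.scale/= !(mul0r, mulr0, add0r, addr0).
  rewrite /T !mulr_sumr -!big_split/=; apply: eq_bigr => i _.
  rewrite factS natrM.
  have ? : (i`!%:R : R) != 0 by rewrite pnatr_eq0 -lt0n fact_gt0.
  have ? : (i.+1%:R : R) != 0 by rewrite pnatr_eq0.
  rewrite /bump/= add1n add0n /=.
  by field; apply/andP.
have := @ge0_is_derive_le R f df _ _ th th0.
move=> H; rewrite -subr_ge0; apply: le_trans (H _ _).
- rewrite /f /T big_ord_recl big1 ?addr0 => [|i _]; last first.
    by rewrite /bump/= expr0n mul0r mul0r.
  rewrite /egf /phi expR0 !subrr mulr0 expR0 expr1n expr0 fact0/= divr1 mul1r !mulr1 expr0n.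
  by case: a {f df dT H} => [|a]; rewrite ?mulr1 ?mul1r ?mulr0 ?mul0r subrr.
- move=> t; exact: is_deriveB.
- move=> t t0; rewrite /df subr_ge0 /degf.
  by rewrite !lerD ?ler_wpM2l// IH.
Qed.

End BlockCount.

(** * Random edge sets *)

Section RandomSubset.
Set Implicit Arguments.
Unset Strict Implicit.
Variables (R : realType) (I : finType) (U : {set I}) (q : I -> R).
Implicit Types (E : {set I}) (f g : {set I} -> R).

(** Law of a random subset of [U] with independent memberships; for [U = upper_pairs N] and
    [q p = rho * Pmat w N p.1 p.2] it is convertible to [edge_weight]. *)
Definition subset_weight E : R :=
  \prod_(p in U) (if p \in E then q p else 1 - q p).

Definition expect f : R :=
  \sum_(E : {set I} | E \subset U) subset_weight E * f E.

Lemma expect_prod (h : I -> bool -> R) :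
  expect (fun E => \prod_(p in U) h p (p \in E))
    = \prod_(p in U) (q p * h p true + (1 - q p) * h p false).
Proof.
(* Off [U], [F] is [0] and [G] is [1], so expanding the product over all subsets keeps exactly those
   inside [U]. *)
pose F p := if p \in U then q p * h p true else 0.
pose G p := if p \in U then (1 - q p) * h p false else 1.
rewrite [RHS]big_mkcond.
transitivity (\prod_p (F p + G p)); last first.
  by apply: eq_bigr => p _; rewrite /F /G; case: ifP => // _; rewrite add0r.
rewrite bigA_distr /expect big_mkcond/=; apply: eq_bigr => E _.
case: ifPn => [EU|/fintype.subsetPn[p pE pU]]; last first.
  by rewrite (bigD1 p)//= pE /F (negbTE pU) mul0r.
rewrite /subset_weight -big_split/= big_mkcond; apply: eq_bigr => p _.
rewrite /F /G; case: ifPn => [pU|pU]; first by case: ifP.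
by case: ifPn => // /(fintype.subsetP EU); rewrite (negbTE pU).
Qed.

Lemma expect1 : expect (fun=> 1) = 1.
Proof.
have := expect_prod (fun _ _ => 1); rewrite !big1_eq => ->.
by apply: big1 => p _; rewrite !mulr1 addrC subrK.
Qed.

Lemma expect_sum (J : finType) (P : pred J) (F : J -> {set I} -> R) :
  expect (fun E => \sum_(j | P j) F j E) = \sum_(j | P j) expect (F j).
Proof.
rewrite exchange_big/=; apply: eq_bigr => E _.
by rewrite mulr_sumr.
Qed.

Lemma eq_expect f g : f =1 g -> expect f = expect g.
Proof. by move=> fg; apply: eq_bigr => E _; rewrite fg. Qed.

Lemma expectZ a f : expect (fun E => a * f E) = a * expect f.
Proof. by rewrite /expect mulr_sumr; apply: eq_bigr => E _; ring. Qed.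

Lemma expectD f g : expect (fun E => f E + g E) = expect f + expect g.
Proof. by rewrite /expect -big_split/=; apply: eq_bigr => E _; ring. Qed.

Hypothesis q01 : forall p, p \in U -> 0 <= q p <= 1.

Lemma subset_weight_ge0 E : 0 <= subset_weight E.
Proof.
by apply: prodr_ge0 => p /q01/andP[? ?]; case: ifP => // _; rewrite subr_ge0.
Qed.

Lemma le_expect f g : (forall E, E \subset U -> f E <= g E) -> expect f <= expect g.
Proof.
by move=> fg; apply: ler_sum => E EU; rewrite ler_wpM2l ?subset_weight_ge0 ?fg.
Qed.

Lemma expect_ge0 f : (forall E, 0 <= f E) -> 0 <= expect f.
Proof.
by move=> f0; apply: sumr_ge0 => E _; rewrite mulr_ge0 ?subset_weight_ge0.
Qed.

Definition centered (p : I) E : R := (p \in E)%:R - q p.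

(** The cardinals of these two sets are the arguments [a] and [b] of [walk_count]. *)
Definition single (es : seq I) : {set I} := [set p | count_mem p es == 1%N].
Definition multiple (es : seq I) : {set I} := [set p | (1 < count_mem p es)%N].

(** The second branch covers a second occurrence, where [e] leaves, and later ones, where the
    removal changes nothing. *)
Lemma single_cons e es : single (e :: es) =
  if count_mem e es == 0%N then e |: single es else single es :\ e.
Proof.
apply/finset.setP => p; case: ifP => H; rewrite !inE/= [e == p]eq_sym;
  have [->|_] := eqVneq p e; rewrite ?add0n ?add1n//= eqSS H.
Qed.

Lemma multiple_cons e es : multiple (e :: es) =
  if count_mem e es == 0%N then multiple es else e |: multiple es.
Proof.
apply/finset.setP => p; case: ifP => H; rewrite !inE/= [e == p]eq_sym;
  have [->|_] := eqVneq p e; rewrite ?add0n ?add1n//= ltnS.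
- by rewrite (eqP H).
- by rewrite lt0n H.
Qed.

Lemma prod_seq_count (f : I -> R) (es : seq I) : {subset es <= U} ->
  \prod_(p <- es) f p = \prod_(p in U) f p ^+ count_mem p es.
Proof.
move=> esU; rewrite -prodr_undup_exp_count/=.
rewrite big_uniq ?undup_uniq//=.
rewrite [LHS]big_mkcond [RHS]big_mkcond; apply: eq_bigr => p _.
rewrite mem_undup; case: ifPn => [/esU -> //|/count_memPn ->].
by rewrite expr0; case: ifP.
Qed.

Variable rho : R.
Hypothesis qrho : forall p, p \in U -> q p <= rho.

(** Central moments of a Bernoulli variable of mean [y]: the total mass at [c = 0], the vanishing
    mean at [c = 1], and from [c = 2] on at most the variance [y * (1 - y)]. *)
Lemma abs_moment_le (c : nat) (y : R) : 0 <= y <= 1 -> y <= rho ->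
  `|y * (1 - y) ^+ c + (1 - y) * (0 - y) ^+ c|
    <= (if c == 1%N then 0 else if (1 < c)%N then rho else 1).
Proof.
move=> /andP[y0 y1] yrho.
have y1' : 0 <= 1 - y by rewrite subr_ge0.
case: c => [|[|c]]; rewrite [leRHS]/=.
- by rewrite !expr0 !mulr1 addrC subrK normr1.
- by rewrite !expr1 sub0r mulrN (mulrC (1 - y)) subrr normr0.
apply: le_trans (ler_normD _ _) _.
rewrite (normrM y ((1 - y) ^+ c.+2)) (normrM (1 - y) ((0 - y) ^+ c.+2)) !normrX.
rewrite sub0r normrN (ger0_norm y0) (ger0_norm y1').
have h (z : R) : 0 <= z -> z <= 1 -> z ^+ c.+2 <= z ^+ 2.
  by move=> z0 z1; apply: ler_wiXn2l.
have := h y y0 y1; have := h (1 - y) y1'.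
rewrite lerBlDr lerDl y0 => /(_ isT) h1 h2.
have := ler_wpM2l y0 h1; have := ler_wpM2l y1' h2.
nra.
Qed.

(* Independence factorises the moment over the distinct edges of [es]; an edge
   occurring once contributes its vanishing mean. *)
Lemma moment_le (es : seq I) : {subset es <= U} ->
  `|expect (fun E => \prod_(p <- es) centered p E)|
    <= (#|single es| == 0%N)%:R * rho ^+ #|multiple es|.
Proof.
move=> esU.
rewrite (eq_expect (g := fun E => \prod_(p in U)
   ((p \in E)%:R - q p) ^+ count_mem p es)); last first.
  by move=> E; rewrite prod_seq_count.
rewrite (expect_prod (fun p b => (b%:R - q p) ^+ count_mem p es)) normr_prod.
have bnd p : p \in U -> 0 <= `|q p * (true%:R - q p) ^+ count_mem p es
    + (1 - q p) * (false%:R - q p) ^+ count_mem p es| <=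
  (if count_mem p es == 1%N then 0 else if (1 < count_mem p es)%N then rho else 1).
  by move=> pU; rewrite normr_ge0 abs_moment_le ?qrho ?q01.
apply: le_trans (ler_prod _ bnd) _.
have inU p : (0 < count_mem p es)%N -> p \in U.
  by rewrite -has_count has_pred1 => /esU.
case: eqP => [/eqP|/eqP]; rewrite cards_eq0.
  move=> /eqP s0; rewrite mul1r -prodr_const.
  rewrite big_mkcond [leRHS]big_mkcond/= le_eqVlt; apply/orP; left; apply/eqP.
  apply: eq_bigr => p _; rewrite inE.
  have : p \notin single es by rewrite s0 inE.
  rewrite inE => /negbTE ->.
  case: ifPn => [_|/negP pU]; first by case: ifP.
  by case: ifP => // /ltnW/inU.
move=> /finset.set0Pn[p]; rewrite inE => /eqP c1.
by rewrite mul0r (bigD1 p)/= ?c1 ?mul0r// inU ?c1.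
Qed.

End RandomSubset.

(** * Walks and the moments of the centred adjacency matrix *)

Section Walks.
Set Implicit Arguments.
Unset Strict Implicit.
Variables (R : realType) (N : nat) (q : 'I_N * 'I_N -> R) (rho : R).
Local Notation U := (upper_pairs N).
Hypotheses (rho01 : 0 <= rho <= 1)
  (q01 : forall p, p \in U -> 0 <= q p) (qrho : forall p, p \in U -> q p <= rho).
Local Notation expect := (expect U q).
Local Notation x := (centered q).

Let q01' p : p \in U -> 0 <= q p <= 1.
Proof.
move=> pU; rewrite q01//=; apply: le_trans (qrho pU) _.
by case/andP: rho01.
Qed.

Definition edge (v u : 'I_N) : 'I_N * 'I_N := if (v < u)%N then (v, u) else (u, v).

Lemma edge_upper v u : v != u -> edge v u \in U.
Proof.
rewrite /edge inE; case: (ltngtP v u) => //= vu.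
by move/eqP; case; exact: val_inj.
Qed.

Lemma edgeC v u : edge v u = edge u v.
Proof.
by rewrite /edge; case: (ltngtP v u) => // /val_inj ->.
Qed.

Lemma edge_inj v : injective (edge v).
Proof.
move=> u u'; rewrite /edge.
by case: (ltnP v u) => vu; case: (ltnP v u') => vu' [] // -> ->.
Qed.

Definition centered_adjacency (E : {set 'I_N * 'I_N}) (v u : 'I_N) : R :=
  if v == u then 0 else x (edge v u) E.
Local Notation X := centered_adjacency.

Lemma centered_adjacencyC E v u : X E v u = X E u v.
Proof. by rewrite /X eq_sym edgeC. Qed.

(* With [nxt v u = u] these are entries of powers of the centred adjacency
   matrix, with [nxt v u = v] they are powers of its row sums. *)
Fixpoint walk_sum (nxt : 'I_N -> 'I_N -> 'I_N) (T0 : 'I_N -> R) (r : nat)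
    (v : 'I_N) (E : {set 'I_N * 'I_N}) : R :=
  if r is r'.+1 then \sum_u X E v u * walk_sum nxt T0 r' (nxt v u) E else T0 v.

Local Notation W := (walk_count N%:R rho).

(** By [edge_inj] the steps out of [v] use distinct edges: at most [N] are new, at most [a] lie in
    [single es] and at most [b] in [multiple es]. *)
Let step_le (r : nat) (v : 'I_N) (es : seq ('I_N * 'I_N)) :
  \sum_(u | v != u) W r #|single (edge v u :: es)| #|multiple (edge v u :: es)|
    <= W r.+1 #|single es| #|multiple es|.
Proof.
have W0 r' a b : 0 <= W r' a b by apply: walk_count_ge0 => //; case/andP: rho01.
set a := #|single es|; set b := #|multiple es|.
pose c u := count_mem (edge v u) es.
(* The first term is kept for every [u], since its multiplicity is bounded by [N] in any case. *)
have bnd u : W r #|single (edge v u :: es)| #|multiple (edge v u :: es)| <=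
   W r a.+1 b + (c u == 1%N)%:R * W r a.-1 b.+1 + (1 < c u)%N%:R * W r a b.
  rewrite single_cons multiple_cons -/(c u).
  case cE : (c u) => [|[|k]] /=.
  - have s0 : edge v u \notin single es by rewrite inE -/(c u) cE.
    by rewrite cardsU1 s0 add1n !mul0r !addr0.
  - have s1 : edge v u \in single es by rewrite inE -/(c u) cE.
    have m0 : edge v u \notin multiple es by rewrite inE -/(c u) cE.
    rewrite cardsU1 m0 add1n /a (cardsD1 (edge v u) (single es)) s1 add1n/=.
    by rewrite mul1r mul0r addr0 lerDr.
  - have s0 : edge v u \notin single es by rewrite inE -/(c u) cE.
    have m1 : edge v u \in multiple es by rewrite inE -/(c u) cE.
    have -> : single es :\ edge v u = single es.
      apply/finset.setP => p; rewrite in_setD1.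
      by case: eqVneq => //= ->; rewrite (negbTE s0).
    rewrite cardsU1 m1 add0n -/a -/b.
    by rewrite mul1r mul0r addr0 lerDr.
have cnt (A : {set 'I_N * 'I_N}) (P : pred 'I_N) :
    (forall u, P u -> edge v u \in A) -> \sum_(u | v != u) (P u)%:R <= #|A|%:R :> R.
  move=> PA; rewrite -natr_sum ler_nat.
  rewrite big_mkcond/= (@leq_trans #|[set u | P u]|)//.
    rewrite -sum1_card [leqRHS]big_mkcond/= leq_sum// => u _.
    by rewrite inE; case: (P u); case: ifP.
  rewrite -(card_imset _ (@edge_inj v)); apply: subset_leq_card.
  by apply/fintype.subsetP => p /imsetP[u]; rewrite inE => /PA ? ->.
apply: le_trans (ler_sum _ (fun u _ => bnd u)) _.
rewrite !big_split/= -!mulr_suml -!addrA.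
apply: lerD; last apply: lerD.
- rewrite sumr_const -[leLHS]mulr_natl ler_wpM2r// ler_nat.
  by rewrite -[leqRHS]card_ord max_card.
- by rewrite ler_wpM2r//; apply: cnt => u cu; rewrite inE.
- by rewrite ler_wpM2r//; apply: cnt => u cu; rewrite inE.
Qed.

(** The list [es] holds the edges already traversed: each step moves one factor of the walk into the
    product, and [moment_le] applies once no step is left. The bound does not depend on the current
    vertex, so [nxt] can be arbitrary. *)
Lemma expect_walk_le nxt T0 : (forall v, 0 <= T0 v <= 1) ->
  forall r v (es : seq ('I_N * 'I_N)), {subset es <= U} ->
  expect (fun E => (\prod_(p <- es) x p E) * walk_sum nxt T0 r v E)
    <= W r #|single es| #|multiple es|.
Proof.
move=> T01; elim=> [|r IH] v es esU.
  rewrite /walk_sum (@eq_expect _ _ _ _ _ (fun E => T0 v * \prod_(p <- es) x p E)); last first.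
    by move=> E; rewrite mulrC.
  rewrite expectZ; apply: le_trans (ler_norm _) _.
  have /andP[t0 t1] := T01 v.
  rewrite normrM ger0_norm//; apply: le_trans (ler_wpM2l t0 (moment_le q01' qrho esU)) _.
  by rewrite ler_piMl// mulr_ge0 ?exprn_ge0//; case/andP: rho01.
apply: le_trans (step_le r v es).
rewrite (@eq_expect _ _ _ _ _ (fun E => \sum_(u | v != u)
   (\prod_(p <- edge v u :: es) x p E) * walk_sum nxt T0 r (nxt v u) E)); last first.
  move=> E; rewrite /= mulr_sumr [RHS]big_mkcond/=; apply: eq_bigr => u _.
  rewrite /X; case: eqVneq => [->|vu] /=; first by rewrite mul0r mulr0.
  by rewrite big_cons; ring.
rewrite expect_sum; apply: ler_sum => u vu; apply: IH => p.
by rewrite inE => /orP[/eqP ->|/esU//]; exact: edge_upper.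
Qed.

Definition row_sum (E : {set 'I_N * 'I_N}) (v : 'I_N) : R := \sum_u X E v u.

Definition centered_mx (E : {set 'I_N * 'I_N}) : 'M[R]_N := \matrix_(v, u) X E v u.

Let single0 : #|single ([::] : seq ('I_N * 'I_N))| = 0%N.
Proof. by apply/eqP; rewrite cards_eq0; apply/eqP/finset.setP => p; rewrite !inE. Qed.

Lemma expect_row_sum_le r v : expect (fun E => row_sum E v ^+ r) <= W r 0 0.
Proof.
have H := @expect_walk_le (fun v _ => v) (fun=> 1) _ r v [::] _.
(* [multiple [::]] is convertible to [single [::]] *)
rewrite !single0 in H; apply: le_trans (H _ _) => //; last by move=> ?; rewrite ler01 lexx.
rewrite le_eqVlt; apply/orP; left; apply/eqP/eq_expect => E.
rewrite big_nil mul1r; elim: r v {H} => [|r IH] v //=.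
by rewrite exprS IH /row_sum mulr_suml.
Qed.

Lemma expect_mxtrace_le r :
  expect (fun E => \tr (centered_mx E ^+ r)) <= N%:R * W r 0 0.
Proof.
rewrite /mxtrace expect_sum.
rewrite -[X in X%:R * _]card_ord mulr_natl -sumr_const; apply: ler_sum => z _.
have H := @expect_walk_le (fun _ u => u) (fun v => (v == z)%:R) _ r z [::] _.
rewrite !single0 in H; apply: le_trans (H _ _) => //; last first.
  by move=> v; case: (v == z); rewrite ?ler01 lexx.
rewrite le_eqVlt; apply/orP; left; apply/eqP/eq_expect => E.
(* Only the start of the closed walk is generalised; its end [z] stays in the column index and the
   indicator. *)
rewrite big_nil mul1r {H}; move: {1 4}z => v.
elim: r v => [|r IH] v /=; first by rewrite expr0 mxE.
by rewrite exprS mxE; apply: eq_bigr => u _; rewrite IH mxE.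
Qed.

End Walks.

(** * Tail bounds *)

Section SpectralBound.
Set Implicit Arguments.
Unset Strict Implicit.
Variables (R : realType) (N : nat).
Implicit Types (u v : 'cV[R]_N) (X : 'M[R]_N) (t : R).

(** Lagrange's identity: twice the defect is a sum of squares. *)
Lemma sum_cauchy_schwarz (I : finType) (f g : I -> R) :
  (\sum_i f i * g i) ^+ 2 <= (\sum_i f i ^+ 2) * (\sum_i g i ^+ 2).
Proof.
have lagrange : 0 <= \sum_i \sum_j (f i * g j - f j * g i) ^+ 2.
  by do 2![apply: sumr_ge0 => ? _]; rewrite sqr_ge0.
suff : \sum_i \sum_j (f i * g j - f j * g i) ^+ 2 =
  2 * ((\sum_i f i ^+ 2) * (\sum_i g i ^+ 2)) - 2 * (\sum_i f i * g i) ^+ 2.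
  by move=> E; rewrite E in lagrange; lra.
have -> : 2 * ((\sum_i f i ^+ 2) * (\sum_i g i ^+ 2)) - 2 * (\sum_i f i * g i) ^+ 2
  = (\sum_i f i ^+ 2) * (\sum_i g i ^+ 2) + (\sum_i g i ^+ 2) * (\sum_i f i ^+ 2)
    - 2 * ((\sum_i f i * g i) * (\sum_i f i * g i)) by ring.
rewrite !big_distrlr/= mulr_sumr -sumrN -!big_split/=; apply: eq_bigr => i _.
rewrite mulr_sumr -sumrN -!big_split/=; apply: eq_bigr => j _; ring.
Qed.

Definition sqnorm v : R := \sum_i v i 0 ^+ 2.

Lemma sqnorm_ge0 v : 0 <= sqnorm v.
Proof. by apply: sumr_ge0 => i _; rewrite sqr_ge0. Qed.

Lemma sqnorm_eq0 v : sqnorm v = 0 -> v = 0.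
Proof.
move=> /eqP; rewrite psumr_eq0 => [/allP v0|i _]; last by rewrite sqr_ge0.
apply/matrixP => i j; rewrite ord1 mxE.
by have := v0 i; rewrite mem_index_enum sqrf_eq0 => /(_ isT)/eqP.
Qed.

(** The Frobenius norm dominates the operator norm, by Cauchy-Schwarz on each row. *)
Lemma sqnorm_mulmx_le X v : sqnorm (X *m v) <= (\sum_i \sum_j X i j ^+ 2) * sqnorm v.
Proof.
rewrite mulr_suml; apply: ler_sum => i _.
by rewrite mxE; exact: (sum_cauchy_schwarz (X i) (v ^~ 0)).
Qed.

Lemma mxtrace_sqr X k : X^T = X -> \tr (X ^+ (k + k)) = \sum_i \sum_j (X ^+ k) i j ^+ 2.
Proof.
move=> Xs; have Xks : (X ^+ k)^T = X ^+ k.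
  by elim: k => [|k IH]; rewrite ?expr0 ?trmx1// [in LHS]exprS trmx_mul IH Xs exprSr.
rewrite exprD; apply: eq_bigr => i _; rewrite mxE; apply: eq_bigr => j _.
by rewrite -{2}Xks mxE expr2.
Qed.

(* [|X^k v|^2] is log-convex in [k], so its first ratio bounds the later ones. *)
Lemma mxtrace_ge X v t k : 0 <= t -> X^T = X ->
  t ^+ 2 * sqnorm v < sqnorm (X *m v) -> t ^+ (k + k) <= \tr (X ^+ (k + k)).
Proof.
move=> t0 Xs Xv; pose a j := sqnorm (X ^+ j *m v).
have aS j : X ^+ j.+1 *m v = X *m (X ^+ j *m v) by rewrite exprS mulmxA.
have v0 : 0 < sqnorm v.
  rewrite lt_neqAle sqnorm_ge0 andbT eq_sym; apply/eqP => /sqnorm_eq0 v0.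
  move: Xv; rewrite v0 mulmx0 /sqnorm big1 ?mulr0 ?ltxx// => i _.
  by rewrite mxE expr0n.
(* By symmetry of [X], [a j.+1] is the inner product of [X^j v] and [X^(j+2) v]. *)
have logconvex j : a j.+1 ^+ 2 <= a j * a j.+2.
  have -> : a j.+1 = \sum_i (X ^+ j *m v) i 0 * (X ^+ j.+2 *m v) i 0.
    have dot (f g : 'cV[R]_N) : \sum_i f i 0 * g i 0 = (f^T *m g) 0 0.
      by rewrite mxE; apply: eq_bigr => i _; rewrite mxE.
    rewrite dot (aS j.+1) mulmxA.
    have -> : (X ^+ j *m v)^T *m X = (X ^+ j.+1 *m v)^T by rewrite aS [in RHS]trmx_mul Xs.
    rewrite /a; move: (X ^+ j.+1 *m v) => u; rewrite mxE /sqnorm.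
    by apply: eq_bigr => i _; rewrite mxE expr2.
  exact: (sum_cauchy_schwarz ((X ^+ j *m v) ^~ 0) ((X ^+ j.+2 *m v) ^~ 0)).
have ratio j : t ^+ 2 * a j <= a j.+1.
  elim: j => [|j IH]; first by rewrite /a expr1 expr0 mul1mx ltW.
  have aj0 := sqnorm_ge0 (X ^+ j *m v); rewrite -/(a j) in aj0.
  have aj2 := sqnorm_ge0 (X ^+ j.+2 *m v); rewrite -/(a j.+2) in aj2.
  have := sqnorm_ge0 (X ^+ j.+1 *m v); rewrite -/(a j.+1) le_eqVlt.
  case/orP => [/eqP <-|aj1]; first by rewrite mulr0.
  rewrite -(ler_pM2l aj1).
  have := logconvex j; have := ler_wpM2r aj2 IH.
  have := sqr_ge0 t; move: (t ^+ 2) => s s0 h1 h2.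
  have := ler_wpM2l s0 h2; nra.
have growth : t ^+ (k + k) * sqnorm v <= a k.
  rewrite addnn -mul2n exprM; elim: {+}k => [|j IH].
    by rewrite expr0 mul1r /a expr0 mul1mx.
  rewrite exprS -mulrA; apply: le_trans (ratio j).
  by rewrite ler_wpM2l ?sqr_ge0.
(* The trace is the squared Frobenius norm of [X^k], which bounds [|X^k v|^2 / |v|^2]. *)
rewrite mxtrace_sqr// -(ler_pM2r v0); apply: le_trans growth _.
exact: sqnorm_mulmx_le.
Qed.

End SpectralBound.

Section Tail.
Set Implicit Arguments.
Unset Strict Implicit.
Variables (R : realType) (I : finType) (U : {set I}) (q : I -> R).
Hypothesis q01 : forall p, p \in U -> 0 <= q p <= 1.
(** [B] is a bad event and [Y r] an [r]-th moment that is large on it; [c] will be [N] for the trace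
    and [1] for a row sum. *)
Variables (n rho c t th : R) (B : pred {set I}) (Y : nat -> {set I} -> R).
Hypotheses (n0 : 0 <= n) (rho0 : 0 <= rho) (c0 : 0 <= c) (th0 : 0 <= th).
Hypothesis Y0 : forall k E, 0 <= Y (k + k) E.
Hypothesis BY : forall k E, B E -> t ^+ (k + k) <= Y (k + k) E.
Hypothesis EY : forall r, expect U q (Y r) <= c * walk_count n rho r 0 0.

(* Chernoff's bound for [cosh], whose moments are the even ones. *)
Lemma tail_bound : expect U q (fun E => (B E)%:R) <=
  2 * c * expR (n * rho * (expR th - 1 - th) - th * t).
Proof.
set p := expect _ _ _.
have p0 : 0 <= p by apply: expect_ge0 => // E; rewrite ler0n.
pose x := th * t.
have markov k : p * t ^+ (k + k) <= c * walk_count n rho (k + k) 0 0.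
  apply: le_trans (EY _); rewrite mulrC -expectZ; apply: le_expect => // E _.
  by case BE : (B E); rewrite ?mulr1 ?mulr0 ?Y0 ?BY.
have W0 r : 0 <= walk_count n rho r 0 0 by exact: walk_count_ge0.
(* At odd [r] the left side cancels and the right side is nonnegative; at even [r] this is [markov],
   doubled. *)
have term r : p * (x ^+ r / r`!%:R + (- x) ^+ r / r`!%:R) <=
    2 * c * (th ^+ r / r`!%:R * walk_count n rho r 0 0).
  have f0 : 0 <= (r`!%:R : R)^-1 by rewrite invr_ge0 ler0n.
  case ro : (odd r).
    rewrite exprNn -signr_odd ro expr1 mulN1r mulNr subrr mulr0.
    by rewrite !mulr_ge0 ?exprn_ge0.
  have -> : r = (r./2 + r./2)%N by rewrite addnn -[LHS]odd_double_half ro.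
  have := markov r./2.
  have -> : (- x) ^+ (r./2 + r./2) = x ^+ (r./2 + r./2).
    by rewrite exprNn -signr_odd oddD addbb expr0 mul1r.
  rewrite /x exprMn; set k := (r./2 + r./2)%N => mk.
  have fk : 0 <= th ^+ k * (k`!%:R)^-1 *+ 2 by rewrite mulrn_wge0 ?mulr_ge0 ?exprn_ge0.
  have := ler_wpM2l fk mk; rewrite mulr2n; lra.
(* Partial sums of [p * (e^x + e^(-x))]; the bound on them passes to the limit, where [e^(-x)] is
   dropped. *)
pose S m := p * (series (exp_coeff x) m + series (exp_coeff (- x)) m).
have S_le m : S m <= 2 * c * expR (n * rho * (expR th - 1 - th)).
  rewrite /S /series/= -big_split/= mulr_sumr big_mkord.
  apply: (@le_trans _ _ (\sum_(r < m) 2 * c * (th ^+ r / r`!%:R * walk_count n rho r 0 0))).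
    by apply: ler_sum => r _; exact: term.
  rewrite -mulr_sumr ler_wpM2l ?mulr_ge0//.
  have := @sum_walk_count_le _ n rho n0 rho0 m 0 0 th th0.
  by rewrite !expr0 !mul1r.
have S_cvg : (S @ \oo --> p * (expR x + expR (- x)))%classic.
  by apply: cvgMr; apply: cvgD; exact: is_cvg_series_exp_coeff.
have pexp : p * expR x <= 2 * c * expR (n * rho * (expR th - 1 - th)).
  apply: (@le_trans _ _ (p * (expR x + expR (- x)))).
    by rewrite ler_wpM2l// lerDl expR_ge0.
  rewrite -(cvg_lim _ S_cvg)//; apply: limr_le; first by apply/cvg_ex; eexists; exact: S_cvg.
  by near=> m; exact: S_le.
by rewrite expRD expRN mulrA ler_pdivlMr ?expR_gt0.
Unshelve. all: by end_near. Qed.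

End Tail.

(** * The good event and its probability *)

Section GoodEvent.
Set Implicit Arguments.
Unset Strict Implicit.
Variables (R : realType) (N : nat) (q : 'I_N * 'I_N -> R) (rho : R).
Local Notation U := (upper_pairs N).
Hypotheses (rho01 : 0 <= rho <= 1)
  (q0 : forall p, p \in U -> 0 <= q p) (qrho : forall p, p \in U -> q p <= rho).

(** The first clause says that the operator norm of the centred matrix is at most [t]. *)
Definition good_event (t : R) (E : {set 'I_N * 'I_N}) : Prop :=
  (forall v, sqnorm (centered_mx q E *m v) <= t ^+ 2 * sqnorm v) /\
  (forall i, `|row_sum q E i| <= t).

Lemma centered_mx_sym E : (centered_mx q E)^T = centered_mx q E.
Proof. by apply/matrixP => i j; rewrite !mxE centered_adjacencyC. Qed.

(** Union bound: the spectral event costs [2 N e^(-s y^2)], and each of the [N] row sums costs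
    [2 e^(-s y^2)]. *)
Lemma good_event_expect (y : R) : 0 <= y <= 3 / 2 ->
  1 - 4 * N%:R * expR (- (N%:R * rho * y ^+ 2))
    <= expect U q (fun E => `[< good_event (2 * (N%:R * rho) * y) E >]%:R).
Proof.
move=> /andP[y0 y32]; set s := N%:R * rho; set t := 2 * s * y.
have [rho0 rho1] := andP rho01.
have s0 : 0 <= s by rewrite mulr_ge0.
have t0 : 0 <= t by rewrite !mulr_ge0.
have q01 p : p \in U -> 0 <= q p <= 1.
  by move=> pU; rewrite q0//= (le_trans (qrho pU)).
pose B1 E := `[< exists v, t ^+ 2 * sqnorm v < sqnorm (centered_mx q E *m v) >].
pose B2 i E := t < `|row_sum q E i|.
(* With [t = 2 s y] the exponent is at most [s y^2 - 2 s y^2]. *)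
have tail : expR (s * (expR y - 1 - y) - y * t) <= expR (- (s * y ^+ 2)).
  rewrite ler_expR /t.
  have := expR_quadratic_le; move=> /(_ R y); rewrite y0 y32 => /(_ isT) ey.
  have := ler_wpM2l s0 ey; nra.
have P1 : expect U q (fun E => (B1 E)%:R) <= 2 * N%:R * expR (- (s * y ^+ 2)).
  apply: le_trans (ler_wpM2l _ tail); last by rewrite mulr_ge0.
  apply: (@tail_bound _ _ _ _ q01 N%:R rho N%:R t y B1
    (fun r E => \tr (centered_mx q E ^+ r))) => //.
  - move=> k E; rewrite mxtrace_sqr ?centered_mx_sym//.
    by do 2![apply: sumr_ge0 => ? _]; rewrite sqr_ge0.
  - by move=> k E /asboolP[v]; apply: mxtrace_ge => //; exact: centered_mx_sym.
  - by move=> r; exact: expect_mxtrace_le.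
have P2 i : expect U q (fun E => (B2 i E)%:R) <= 2 * expR (- (s * y ^+ 2)).
  apply: le_trans (ler_wpM2l _ tail) => //; rewrite -[X in _ <= X * _]mulr1.
  apply: (@tail_bound _ _ _ _ q01 N%:R rho 1 t y (B2 i)
    (fun r E => row_sum q E i ^+ r)) => //.
  - by move=> k E; rewrite addnn exprn_even_ge0// odd_double.
  - move=> k E /ltW tE; rewrite -[leRHS]ger0_norm; last first.
      by rewrite addnn exprn_even_ge0// odd_double.
    by rewrite normrX lerXn2r// nnegrE.
  - by move=> r; rewrite mul1r; exact: expect_row_sum_le.
have union : 1 <= expect U q (fun E => `[< good_event t E >]%:R
    + ((B1 E)%:R + \sum_i (B2 i E)%:R)).
  rewrite -[leLHS](expect1 U q); apply: le_expect => // E _.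
  have S0 : 0 <= \sum_i (B2 i E)%:R :> R by apply: sumr_ge0 => i _; rewrite ler0n.
  case: (boolP `[< good_event t E >]) => [_|/asboolPn bad].
    by rewrite lerDl addr_ge0.
  rewrite add0r; case: (boolP (B1 E)) => [_|/asboolPn nB1]; first by rewrite lerDl.
  rewrite add0r.
  have [i Bi] : exists i, B2 i E.
    apply: contrapT => nB2; apply: bad; split.
      by move=> v; rewrite leNgt; apply/negP => h; apply: nB1; exists v.
    by move=> i; rewrite leNgt; apply/negP => h; apply: nB2; exists i.
  by rewrite (bigD1 i)//= Bi lerDl; apply: sumr_ge0 => j _; rewrite ler0n.
rewrite !expectD expect_sum in union.
have : \sum_i expect U q (fun E => (B2 i E)%:R) <= N%:R * (2 * expR (- (s * y ^+ 2))).
  apply: le_trans (ler_sum _ (fun i _ => P2 i)) _.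
  by rewrite sumr_const card_ord -[leLHS]mulr_natl.
by move: P1 union; set e := expR _; lra.
Qed.

End GoodEvent.

(** * Integrals over the unit interval *)

Section UnitInterval.
Set Implicit Arguments.
Unset Strict Implicit.
Local Open Scope classical_set_scope.
Local Open Scope ring_scope.
Variable R : realType.
Local Notation mu := (@lebesgue_measure R).
Local Notation I := (@I01 R).
Implicit Types f g h : R -> R.

(** The integral of a nonnegative function is a supremum over the simple functions below it, hence
    monotone for arbitrary functions. This serves [opnorm], which integrates [(T f)^2] for an
    operator [T] with no measurability attached. *)
Lemma le_integral_nonmeasurable d (T : measurableType d)
    (nu : {measure set T -> \bar R}) (D : set T) (f1 f2 : T -> \bar R) :
  (forall x, D x -> 0 <= f1 x)%E -> (forall x, D x -> f1 x <= f2 x)%E ->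
  (\int[nu]_(x in D) f1 x <= \int[nu]_(x in D) f2 x)%E.
Proof.
move=> f10 f12; rewrite !(integral_mkcond D).
rewrite !ge0_integralTE; last 2 first.
- by apply: erestrict_ge0 => x Dx; apply: le_trans (f10 _ Dx) (f12 _ Dx).
- exact: erestrict_ge0.
apply: ereal_sup_le => _ [h /= hf <-]; exists h => //= x.
by apply: le_trans (hf x) _; exact: lee_restrict.
Qed.

Lemma measurable_I01 : measurable (I : set (measurableTypeR R)).
Proof. exact: measurable_itv. Qed.
Hint Resolve measurable_I01 : core.

Lemma lebesgue_I01 : mu I = 1%E.
Proof. by rewrite /I01 lebesgue_measure_itv/= lte_fin ltr01 oppr0 adde0. Qed.

Definition int01 f := mu.-integrable I (EFin \o f).
Local Notation integral f := (Rintegral mu I f).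

Lemma int01_measurable f : int01 f -> measurable_fun I f.
Proof. by move=> /(measurable_int mu) /measurable_EFinP. Qed.

Lemma int01_cst (c : R) : int01 (fun=> c).
Proof.
apply/integrableP; split; first exact: measurable_cst.
by rewrite /= integral_cst//= lebesgue_I01 mule1 ltry.
Qed.

Lemma int01D f g : int01 f -> int01 g -> int01 (fun x => f x + g x).
Proof. by move=> hf hg; have := integrableD measurable_I01 hf hg. Qed.

Lemma int01Z c f : int01 f -> int01 (fun x => c * f x).
Proof. by move=> hf; have := integrableZl measurable_I01 c hf. Qed.

Lemma int01B f g : int01 f -> int01 g -> int01 (fun x => f x - g x).
Proof.
move=> hf hg; have -> : (fun x => f x - g x) = (fun x => f x + (-1) * g x).
  by apply/funext => x; rewrite mulN1r.
by apply: int01D => //; exact: int01Z.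
Qed.

Lemma int01_sum (J : finType) (F : J -> R -> R) :
  (forall j, int01 (F j)) -> int01 (fun x => \sum_j F j x).
Proof.
move=> hF; rewrite /int01.
have -> : EFin \o (fun x => \sum_j F j x) = (fun x => \sum_j (EFin \o F j) x)%E.
  by apply/funext => x; rewrite /= sumEFin.
by apply: integrable_sum => // j _; exact: hF.
Qed.

Lemma integral01_sum (J : finType) (F : J -> R -> R) : (forall j, int01 (F j)) ->
  integral (fun x => \sum_j F j x) = \sum_j integral (F j).
Proof.
move=> hF; rewrite -[in RHS]big_enum/=.
transitivity (integral (fun x => \sum_(j <- enum J) F j x)).
  by apply: eq_Rintegral => x _; rewrite big_enum.
elim: (enum J) => [|j s IH].
  rewrite big_nil; under eq_Rintegral do rewrite big_nil.
  by rewrite Rintegral_cst// mul0r.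
rewrite big_cons -IH -RintegralD//; [|exact: hF|]; last first.
  have -> : EFin \o (fun x => \sum_(j <- s) F j x) = (fun x => \sum_(j <- s) (EFin \o F j) x)%E.
    by apply/funext => x; rewrite /= sumEFin.
  by apply: integrable_sum => // i _; exact: hF.
by apply: eq_Rintegral => x _; rewrite big_cons.
Qed.

Lemma integral01_cst (c : R) : integral (fun=> c) = c.
Proof. by rewrite Rintegral_cst//= lebesgue_I01/= mulr1. Qed.

Lemma int01_le f g : measurable_fun I f -> int01 g ->
  (forall x, I x -> `|f x| <= g x) -> int01 f.
Proof.
move=> mf hg fg; apply: (le_integrable _ _ _ hg) => //.
  exact/measurable_EFinP.
by move=> x Ix; rewrite /= lee_fin (le_trans (fg _ Ix))// ler_norm.
Qed.

Lemma int01_mul_bounded f g (C : R) : measurable_fun I f -> int01 g ->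
  (forall x, I x -> `|f x| <= C) -> int01 (fun x => f x * g x).
Proof.
move=> mf hg fC.
apply: (@int01_le _ (fun x => C * `|g x|)).
- by apply: measurable_funM => //; exact: int01_measurable.
- by apply: int01Z; have := integrable_norm hg.
- by move=> x Ix; rewrite normrM ler_wpM2r// fC.
Qed.

Lemma int01_norm f : int01 f -> int01 (fun x => `|f x|).
Proof. by move=> hf; have := integrable_norm hf. Qed.

Lemma int01_sqr_int01 f : measurable_fun I f ->
  int01 (fun x => f x ^+ 2) -> int01 f.
Proof.
move=> mf hf2; apply: (@int01_le _ (fun x => 1 + f x ^+ 2)) => //.
  by apply: int01D => //; exact: int01_cst.
move=> x _; rewrite -real_normK ?num_real//.
by have := sqr_ge0 (`|f x| - 1); have := normr_ge0 (f x); nra.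
Qed.

Lemma integral01_EFin f : int01 f -> (\int[mu]_(x in I) (f x)%:E)%E = (integral f)%:E.
Proof. by move=> hf; rewrite fineK//; exact: integrable_fin_num. Qed.

(** The variance of [|f|] is nonnegative. *)
Lemma integral_norm_sqr f : int01 f -> int01 (fun x => f x ^+ 2) ->
  (integral (fun x => `|f x|)) ^+ 2 <= integral (fun x => f x ^+ 2).
Proof.
move=> hf hf2; set A := integral _.
have : 0 <= integral (fun x => (f x ^+ 2 - 2 * A * `|f x|) + A ^+ 2).
  apply: Rintegral_ge0 => x _; rewrite -(real_normK (num_real (f x))).
  by have := sqr_ge0 (`|f x| - A); nra.
have hn := int01_norm hf.
rewrite RintegralD//; [|by apply: int01B => //; exact: int01Z|exact: int01_cst].
rewrite RintegralB//; [|exact: int01Z].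
by rewrite RintegralZl// integral01_cst -/A; nra.
Qed.

(** Since [g] is controlled on [[0, 1]] alone, it is composed with the clamp [cl] onto that
    interval; the composite is continuous on the line and agrees with [g] there. *)
Lemma lipschitz_measurable g (K : R) :
  (forall y z, y \in `[0, 1] -> z \in `[0, 1] -> `|g y - g z| <= K * `|y - z|) ->
  measurable_fun I g.
Proof.
move=> gK.
pose cl (y : R) := if y < 0 then 0 else if 1 < y then 1 else y.
have cl01 y : cl y \in `[0, 1].
  by rewrite /cl in_itv/=; case: ltP => ?; [|case: ltP => ?]; lra.
have clip y z : `|cl y - cl z| <= `|y - z|.
  rewrite /cl; case: (ltP y 0) => ?; [|case: (ltP 1 y) => ?];
    (case: (ltP z 0) => ?; [|case: (ltP 1 z) => ?]);
    rewrite ?subrr ?normr0 ?normr_ge0// ler_norml;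
    have := ler_norm (y - z); have := ler_norm (z - y); rewrite (distrC z y);
    move=> h1 h2; apply/andP; split; lra.
have K0 : 0 <= K.
  have := gK 0 1; rewrite !in_itv/= !lexx !ler01 => /(_ isT isT).
  by rewrite sub0r normrN normr1 mulr1; apply: le_trans.
have cg : continuous (g \o cl).
  move=> y; apply/(@cvgrPdist_le _ R^o) => e e0; near=> z.
  rewrite /= (le_trans (gK _ _ (cl01 _) (cl01 _)))//.
  (* [K + 1] is positive even if [K] is [0], so it can be divided by. *)
  apply: (@le_trans _ _ ((K + 1) * `|y - z|)).
    by apply: ler_pM => //; rewrite lerDl.
  rewrite mulrC -ler_pdivlMr; last by lra.
  near: z; apply/nbhs_ballP; exists (e / (K + 1)) => /=.
    by apply: divr_gt0 => //; lra.
  by move=> z; rewrite /ball/= => /ltW.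
have mg : measurable_fun I (g \o cl).
  by apply: measurable_funTS; exact: continuous_measurable_fun.
apply: (eq_measurable_fun (g \o cl)) => // y; rewrite inE /I01/= in_itv/= => /andP[y0 y1].
by rewrite /cl ltNge y0/= ltNge y1.
Unshelve. all: by end_near. Qed.

(** An integrable majorant [g] of [(T f)^2] stands in for measurability of [T f]. *)
Lemma opnorm_le (T : (R -> R) -> R -> R) (c : R) : 0 <= c ->
  (forall f, measurable_fun I f -> int01 (fun x => f x ^+ 2) ->
     integral (fun x => f x ^+ 2) <= 1 ->
     exists2 g, int01 g & (forall x, I x -> T f x ^+ 2 <= g x) /\ integral g <= c ^+ 2) ->
  (opnorm T <= c%:E)%E.
Proof.
move=> c0 H; apply: ge_ereal_sup => _ [f /= [mf f1] <-].
have sq0 h : (0 <= \int[mu]_(x in I) ((h x) ^+ 2)%:E)%E.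
  by apply: integral_ge0 => x _; rewrite lee_fin sqr_ge0.
have f2oo : (\int[mu]_(x in I) ((f x) ^+ 2)%:E < +oo)%E.
  apply: (@lty_poweRy _ _ 2^-1) => //.
  by apply: le_lt_trans f1 _; rewrite ltry.
have f2 : int01 (fun x => f x ^+ 2).
  apply/integrableP; split; first exact/measurable_EFinP/measurable_funX.
  by under eq_integral do rewrite /= ger0_norm ?sqr_ge0//.
have f21 : integral (fun x => f x ^+ 2) <= 1.
  move: f1; rewrite /l2norm integral01_EFin// poweR_EFin lee_fin.
  have i0 : 0 <= integral (fun x => f x ^+ 2).
    by apply: Rintegral_ge0 => x _; rewrite sqr_ge0.
  rewrite powR12_sqrt// => s1; rewrite -[leLHS]sqr_sqrtr//.
  by rewrite expr_le1// sqrtr_ge0.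
have [g hg [Tg gc]] := H f mf f2 f21.
rewrite /l2norm (_ : c%:E = poweR (c ^+ 2)%:E 2^-1); last first.
  by rewrite poweR_EFin powR12_sqrt ?sqr_ge0// sqrtr_sqr ger0_norm.
apply: gt0_ler_poweR; rewrite ?in_itv/= ?leey ?andbT ?lee_fin ?sqr_ge0 ?invr_ge0//.
apply: (@le_trans _ _ (\int[mu]_(x in I) (g x)%:E)%E).
  by apply: le_integral_nonmeasurable => x Ix; rewrite lee_fin ?sqr_ge0// Tg.
by rewrite integral01_EFin// lee_fin.
Qed.

End UnitInterval.

(** * Step graphons *)

Section Cells.
Set Implicit Arguments.
Unset Strict Implicit.
Local Open Scope classical_set_scope.
Local Open Scope ring_scope.
Variables (R : realType) (N : nat).
Hypothesis N_gt0 : (0 < N)%N.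
Local Notation mu := (@lebesgue_measure R).
Local Notation I := (@I01 R).
Local Notation integral f := (Rintegral mu I f).
Implicit Types (x y : R) (j k : 'I_N) (f : R -> R) (P : 'M[R]_N).

Let NR0 : 0 < N%:R :> R. Proof. by rewrite ltr0n. Qed.

Lemma cell_exists x : x \in `[0, 1] -> exists k, x \in cell R N k.
Proof.
rewrite in_itv/= => /andP[x0 x1].
(* The least such [k] is taken: minimality gives the strict lower bound of the cell when [k > 0]. *)
have ex : exists k : nat, x <= k.+1%:R / N%:R.
  by exists N.-1; rewrite prednK// divff// gt_eqF.
case: (ex_minnP ex) => k xk kmin.
have kN : (k < N)%N.
  rewrite -(ltn_predK N_gt0) ltnS; apply: kmin.
  by rewrite prednK// divff// gt_eqF.
exists (Ordinal kN); rewrite /cell/=; case: eqP => [k0|/eqP k0].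
  by rewrite in_itv/= x0; move: xk; rewrite k0 div1r.
rewrite in_itv/= xk andbT ltNge; apply/negP => xk'.
have := kmin k.-1; rewrite prednK ?lt0n// => /(_ xk').
by rewrite -ltnS prednK ?lt0n// ltnn.
Qed.

Lemma cell_le x k : x \in cell R N k -> x <= k.+1%:R / N%:R.
Proof.
rewrite /cell; case: eqP => [->|_]; rewrite in_itv/= => /andP[_]//.
by rewrite div1r.
Qed.

Lemma cell_gt x k : x \in cell R N k -> (0 < k)%N -> k%:R / N%:R < x.
Proof.
rewrite /cell; case: eqP => [->//|_].
by rewrite in_itv/= => /andP[].
Qed.

Lemma cell_sub x k : x \in cell R N k -> x \in `[0, 1].
Proof.
move=> xk; rewrite in_itv/=; apply/andP; split.
  have [k0|k0] := posnP k; last by rewrite ltW// (le_lt_trans _ (cell_gt xk k0)) ?divr_ge0.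
  by move: xk; rewrite /cell k0 eqxx in_itv/= => /andP[].
by rewrite (le_trans (cell_le xk))// ler_pdivrMr// mul1r ler_nat.
Qed.

Lemma cell_uniq x j k : x \in cell R N j -> x \in cell R N k -> j = k.
Proof.
have lt_absurd (i l : 'I_N) : x \in cell R N i -> x \in cell R N l -> ~ (i < l)%N.
  move=> xi xl il; have := cell_gt xl (leq_ltn_trans (leq0n _) il).
  by rewrite ltNge (le_trans (cell_le xi))// ler_pM2r ?invr_gt0// ler_nat.
move=> xj xk; apply/val_inj; case: (ltngtP j k) => // h.
  by case: (lt_absurd _ _ xj xk).
by case: (lt_absurd _ _ xk xj).
Qed.

(** The vertex [k.+1 / N] is the right end of the cell, whose length is [1 / N]. *)
Lemma cell_dist x k : x \in cell R N k -> `|x - k.+1%:R / N%:R| <= N%:R^-1.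
Proof.
move=> xk; rewrite distrC ger0_norm ?subr_ge0 ?cell_le//.
rewrite -natr1 mulrDl div1r addrAC gerDr subr_le0.
have [k0|k0] := posnP k; last exact/ltW/cell_gt.
by rewrite k0 mul0r; have := cell_sub xk; rewrite in_itv/= => /andP[].
Qed.

Lemma vertex_in k : k.+1%:R / N%:R \in `[(0 : R), 1].
Proof. by rewrite in_itv/= divr_ge0//= ler_pdivrMr// mul1r ler_nat. Qed.

Let ind k x : R := (x \in cell R N k)%:R.

Lemma sum_ind (c : 'I_N -> R) x k : x \in cell R N k -> \sum_j c j * ind j x = c k.
Proof.
move=> xk; rewrite (bigD1 k)//= /ind xk mulr1 big1 ?addr0// => j jk.
case: (boolP (x \in cell R N j)) => [xj|_]; last by rewrite mulr0.
by rewrite (cell_uniq xj xk) eqxx in jk.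
Qed.

Lemma stepgraphonE P x y k : x \in cell R N k ->
  stepgraphon P x y = \sum_j P k j * ind j y.
Proof.
move=> xk; rewrite /stepgraphon exchange_big/=; apply: eq_bigr => j _.
by rewrite -mulr_suml (sum_ind (P ^~ j) xk).
Qed.

Let ind_indic k : ind k = \1_[set` cell R N k].
Proof. by apply/funext => x; rewrite indicE mem_setE. Qed.

Lemma measurable_ind k : measurable_fun I (ind k).
Proof.
rewrite ind_indic; apply: measurable_indic.
by rewrite /cell; case: ifP => _; exact: measurable_itv.
Qed.

Lemma integral_ind k : integral (ind k) = N%:R^-1.
Proof.
rewrite /Rintegral ind_indic integral_indic//; last exact: measurable_I01.
rewrite setIidl; last by move=> x /= /cell_sub.
rewrite /cell; case: eqP => [_|_] /=; rewrite lebesgue_measure_itv/= lte_fin.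
  by rewrite invr_gt0 NR0 oppr0 adde0.
rewrite ltr_pM2r ?invr_gt0// ltr_nat ltnS leqnn/=.
by rewrite -mulrBl -natrB// subSnn div1r.
Qed.

Lemma int01_ind k f : int01 f -> int01 (fun y => ind k y * f y).
Proof.
move=> hf; apply: (int01_mul_bounded (C := 1) (measurable_ind k) hf) => x _.
by rewrite /ind; case: (_ \in _); rewrite ?normr1 ?normr0.
Qed.

Let mass f k := integral (fun y => ind k y * f y).

Lemma sum_mass f : int01 f -> \sum_k mass f k = integral f.
Proof.
move=> hf; rewrite -integral01_sum; last by move=> k; exact: int01_ind.
apply: eq_Rintegral => x; rewrite inE => /cell_exists[k xk].
by rewrite -mulr_suml; have := sum_ind (fun=> 1) xk;
  under eq_bigr do rewrite mul1r; move=> ->; rewrite mul1r.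
Qed.

Lemma int01_indk k : int01 (ind k).
Proof.
have -> : ind k = (fun y => ind k y * 1) by apply/funext => y; rewrite mulr1.
by apply: int01_ind; exact: int01_cst.
Qed.

Lemma measurable_stepgraphon P x : x \in `[0, 1] -> measurable_fun I (stepgraphon P x).
Proof.
move=> /cell_exists[k xk].
apply: (@int01_measurable _ (stepgraphon P x)).
rewrite (_ : stepgraphon P x = fun y => \sum_j P k j * ind j y); last first.
  by apply/funext => y; exact: stepgraphonE.
by apply: int01_sum => j; apply: int01Z; exact: int01_indk.
Qed.

(** On one cell the operator is affine in [f x] with constant coefficients, so its square can be
    integrated cell by cell. *)
Lemma glaplacian_step P f x k : int01 f -> x \in cell R N k ->
  glaplacian (stepgraphon P) f x =
    (\sum_j P k j) / N%:R * f x - \sum_j P k j * mass f j.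
Proof.
move=> hf xk; rewrite /glaplacian.
transitivity (integral (fun y => \sum_j P k j * (f x * ind j y - ind j y * f y))).
  apply: eq_Rintegral => y _; rewrite (stepgraphonE _ _ xk) mulr_suml.
  by apply: eq_bigr => j _; ring.
have hj j : int01 (fun y => f x * ind j y - ind j y * f y).
  by apply: int01B; [apply: int01Z; exact: int01_indk|exact: int01_ind].
rewrite integral01_sum => [|j]; last exact: int01Z.
rewrite 2!mulr_suml -sumrB; apply: eq_bigr => j _.
rewrite RintegralZl; [|exact: measurable_I01|exact: hj].
rewrite RintegralB; [|exact: measurable_I01|by apply: int01Z; exact: int01_indk|exact: int01_ind].
rewrite RintegralZl; [|exact: measurable_I01|exact: int01_indk].
by rewrite integral_ind /mass; ring.
Qed.

Section Quadratic.
Variables (f : R -> R).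
Hypotheses (hf : int01 f) (hf2 : int01 (fun x => f x ^+ 2)).

Lemma int01_affine_sqr (m c : R) : int01 (fun x => (m * f x - c) ^+ 2).
Proof.
rewrite (_ : (fun x => _) = (fun x => m ^+ 2 * f x ^+ 2 + (- 2 * m * c) * f x + c ^+ 2)).
  by apply: int01D; [apply: int01D; exact: int01Z|exact: int01_cst].
by apply/funext => x; ring.
Qed.

Lemma mass_affine_sqr k (m c : R) : mass (fun x => (m * f x - c) ^+ 2) k =
  m ^+ 2 * mass (fun x => f x ^+ 2) k - 2 * m * c * mass f k + c ^+ 2 / N%:R.
Proof.
transitivity (integral (fun x => (m ^+ 2 * (ind k x * f x ^+ 2)
    + (- 2 * m * c) * (ind k x * f x)) + c ^+ 2 * ind k x)).
  by apply: eq_Rintegral => x _; ring.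
have mI := @measurable_I01 R.
have h1 := int01_ind k hf2; have h2 := int01_ind k hf; have h3 := int01_indk k.
rewrite RintegralD//; [|by apply: int01D; exact: int01Z|exact: int01Z].
rewrite RintegralD//; [|exact: int01Z|exact: int01Z].
by rewrite !RintegralZl// integral_ind /mass; ring.
Qed.

(** The variance of [f] on the cell is nonnegative, the cell mean being [N * mass f k]. *)
Lemma mass_sqr_ge k : N%:R * mass f k ^+ 2 <= mass (fun x => f x ^+ 2) k.
Proof.
have : 0 <= mass (fun x => (1 * f x - N%:R * mass f k) ^+ 2) k.
  by apply: Rintegral_ge0 => x _; rewrite mulr_ge0 ?sqr_ge0// /ind ler0n.
rewrite mass_affine_sqr (_ : (N%:R * mass f k) ^+ 2 / N%:R = N%:R * mass f k ^+ 2).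
  by nra.
by field; rewrite gt_eqF.
Qed.

(* On each cell [f] splits into its mean and an orthogonal mean-zero part. The
   operator acts on the cell means as the discrete Laplacian, and multiplies the
   mean-zero part by the mean row sum [m k]. *)
Lemma step_sqr_le P (kap : R) : 0 <= kap ->
  (forall k, `|(\sum_j P k j) / N%:R| <= kap) ->
  (forall a : 'cV[R]_N, \sum_k ((\sum_j P k j) * a k 0 - \sum_j P k j * a j 0) ^+ 2
     <= (kap * N%:R) ^+ 2 * sqnorm a) ->
  exists2 g, int01 g & (forall x, I x -> glaplacian (stepgraphon P) f x ^+ 2 <= g x)
    /\ integral g <= kap ^+ 2 * integral (fun x => f x ^+ 2).
Proof.
move=> kap0 deg_le lap_le.
pose m k := (\sum_j P k j) / N%:R; pose c k := \sum_j P k j * mass f j.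
pose b := mass (fun x => f x ^+ 2).
have hk k : int01 (fun x => ind k x * (m k * f x - c k) ^+ 2).
  by apply: int01_ind; exact: int01_affine_sqr.
exists (fun x => \sum_k ind k x * (m k * f x - c k) ^+ 2); first exact: int01_sum.
split.
  move=> x /cell_exists[k xk]; rewrite (glaplacian_step _ hf xk).
  rewrite [leRHS](_ : _ = (m k * f x - c k) ^+ 2)//.
  rewrite -(sum_ind (fun k => (m k * f x - c k) ^+ 2) xk).
  by apply: eq_bigr => j _; rewrite mulrC.
rewrite integral01_sum// -(sum_mass hf2).
(* Completing the square in the cell mean separates the variance on each cell from the discrete
   Laplacian. *)
have -> : \sum_k integral (fun x => ind k x * (m k * f x - c k) ^+ 2) =
   \sum_k m k ^+ 2 * (b k - N%:R * mass f k ^+ 2)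
     + (\sum_k ((\sum_j P k j) * mass f k - \sum_j P k j * mass f j) ^+ 2) / N%:R.
  rewrite mulr_suml -big_split/=; apply: eq_bigr => k _.
  rewrite -/(mass (fun x => (m k * f x - c k) ^+ 2) k) mass_affine_sqr -/(b k) -/(c k) /m.
  by field; rewrite gt_eqF.
have := lap_le (\col_k mass f k).
rewrite (eq_bigr (fun k => ((\sum_j P k j) * mass f k - \sum_j P k j * mass f j) ^+ 2)); last first.
  by move=> k _; rewrite mxE; congr ((_ - _) ^+ 2); apply: eq_bigr => j _; rewrite mxE.
have -> : sqnorm (\col_k mass f k) = \sum_k mass f k ^+ 2.
  by apply: eq_bigr => k _; rewrite mxE.
move=> lap.
have diag : \sum_k m k ^+ 2 * (b k - N%:R * mass f k ^+ 2)
    <= kap ^+ 2 * \sum_k b k - kap ^+ 2 * N%:R * \sum_k mass f k ^+ 2.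
  rewrite !mulr_sumr -sumrB; apply: ler_sum => k _.
  rewrite -mulrA -mulrBr ler_wpM2r ?subr_ge0 ?mass_sqr_ge//.
  by rewrite -real_normK ?num_real// lerXn2r ?nnegrE ?deg_le.
(* The negative term of [diag] absorbs the Laplacian part. *)
apply: le_trans (lerD diag (lexx _)) _; rewrite -lerBrDl.
rewrite opprB addrCA subrr addr0 ler_pdivrMr//; apply: le_trans lap _.
by rewrite exprMn; lra.
Qed.

End Quadratic.

End Cells.

(** * Comparison with the graphon and concentration *)

Lemma sqr_le_norm (R : realDomainType) (u v : R) : `|u| <= v -> u ^+ 2 <= v ^+ 2.
Proof.
move=> uv; rewrite -(real_normK (num_real u)) lerXn2r ?nnegrE//.
exact: le_trans uv.
Qed.

Section Concentration.
Set Implicit Arguments.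
Unset Strict Implicit.
Local Open Scope classical_set_scope.
Local Open Scope ring_scope.
Variables (R : realType) (w : R -> R -> R) (K : R).
Hypotheses (w_graphon : is_graphon w) (wK : lipschitzA1 w K).
Local Notation mu := (@lebesgue_measure R).
Local Notation I := (@I01 R).
Local Notation integral f := (Rintegral mu I f).
Implicit Types (x y : R) (f g : R -> R).

Lemma measurable_graphon x : x \in `[0, 1] -> measurable_fun I (w x).
Proof.
move=> x01; apply: (@lipschitz_measurable _ _ K) => y z y01 z01.
by have := wK.2 x y x z x01 y01 x01 z01; rewrite subrr normr0 add0r.
Qed.

Lemma degree_le1 x : x \in `[0, 1] -> degree w x <= 1.
Proof.
move=> x01; rewrite -[leRHS](@integral01_cst R 1) /degree.
have b y : I y -> 0 <= w x y <= 1 by move=> y01; exact: w_graphon.1.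
apply: le_Rintegral; [exact: measurable_I01| |exact: int01_cst|].
  apply: (int01_le (g := fun=> 1) (measurable_graphon x01)); first exact: int01_cst.
  by move=> y /b/andP[? ?]; rewrite ger0_norm.
by move=> y /b/andP[].
Qed.

(** It turns the degree condition into an upper bound on [ln (4 N / eps) / (rho N)]. *)
Lemma dMAX_le1 : dMAX w <= 1.
Proof.
apply: ge_sup; last by move=> _ [x x01 <-]; exact: degree_le1.
by exists (degree w 0), 0 => //; rewrite /I01/= in_itv/= lexx ler01.
Qed.

Section FixedN.
Variable N : nat.
Hypothesis N_gt0 : (0 < N)%N.

Let NR0 : 0 < N%:R :> R. Proof. by rewrite ltr0n. Qed.

Lemma wN_dist x y : x \in `[0, 1] -> y \in `[0, 1] ->
  `|wN w N x y - w x y| <= 2 * K / N%:R.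
Proof.
move=> x01 y01; have [k xk] := cell_exists N_gt0 x01; have [j yj] := cell_exists N_gt0 y01.
rewrite /wN (stepgraphonE N_gt0 _ _ xk) (sum_ind N_gt0 _ yj) mxE distrC.
apply: le_trans (wK.2 _ _ _ _ x01 y01 (vertex_in R N_gt0 k) (vertex_in R N_gt0 j)) _.
have -> : 2 * K / N%:R = K * (2 / N%:R) by ring.
rewrite ler_pM2l ?wK.1//.
by have := cell_dist N_gt0 xk; have := cell_dist N_gt0 yj; lra.
Qed.

Lemma glaplacian_wN_dist f x : int01 f -> x \in `[0, 1] ->
  `|glaplacian (wN w N) f x - glaplacian w f x|
    <= 2 * K / N%:R * (`|f x| + integral (fun y => `|f y|)).
Proof.
move=> hf x01; have mI := @measurable_I01 R.
have hd : int01 (fun y => f x - f y) by apply: int01B => //; exact: int01_cst.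
have mN : measurable_fun I (wN w N x) by exact: measurable_stepgraphon.
have mw := measurable_graphon x01.
have c0 : 0 <= 2 * K / N%:R by rewrite divr_ge0// mulr_ge0// ltW ?wK.1.
have hw : int01 (fun y => w x y * (f x - f y)).
  apply: (int01_mul_bounded (C := 1)) => // y y01.
  by have /andP[? ?] := w_graphon.1 x y x01 y01; rewrite ger0_norm.
have hN : int01 (fun y => wN w N x y * (f x - f y)).
  apply: (int01_mul_bounded (C := 1 + 2 * K / N%:R)) => // y y01.
  have /andP[? ?] := w_graphon.1 x y x01 y01.
  have -> : wN w N x y = w x y + (wN w N x y - w x y) by ring.
  apply: le_trans (ler_normD _ _) _; apply: lerD; last exact: wN_dist.
  by rewrite ger0_norm.
rewrite /glaplacian -RintegralB//.
apply: le_trans (le_normr_Rintegral _ _) _ => //; first exact: int01B.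
have hfn := int01_norm hf.
have hs : int01 (fun y => `|f x| + `|f y|) by apply: int01D => //; exact: int01_cst.
apply: (@le_trans _ _ (integral (fun y => 2 * K / N%:R * (`|f x| + `|f y|)))).
  apply: le_Rintegral => //; first by apply: int01_norm; exact: int01B.
    exact: int01Z.
  move=> y y01; rewrite -mulrBl normrM.
  by apply: ler_pM => //; [exact: wN_dist|exact: ler_normB].
by rewrite RintegralZl// RintegralD// ?integral01_cst//; exact: int01_cst.
Qed.

(** With [c = 2 K / N], the pointwise bound is squared by [(a + b)^2 <= 2 (a^2 + b^2)]; as
    [(int |f|)^2 <= int f^2], the integral is at most [4 c^2 int f^2]. *)
Lemma glaplacian_wN_sqr f : int01 f -> int01 (fun x => f x ^+ 2) ->
  exists2 g, int01 g &
    (forall x, I x -> (glaplacian (wN w N) f x - glaplacian w f x) ^+ 2 <= g x)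
    /\ integral g <= (4 * K / N%:R) ^+ 2 * integral (fun x => f x ^+ 2).
Proof.
move=> hf hf2; pose c := 2 * K / N%:R; pose A := integral (fun y => `|f y|).
have hs : int01 (fun x => f x ^+ 2 + A ^+ 2) by apply: int01D => //; exact: int01_cst.
exists (fun x => 2 * c ^+ 2 * (f x ^+ 2 + A ^+ 2)); first exact: int01Z.
have A0 : 0 <= A by apply: Rintegral_ge0 => y _; rewrite normr_ge0.
have c0 : 0 <= c by rewrite divr_ge0// mulr_ge0// ltW ?wK.1.
split=> [x x01|].
  apply: (@le_trans _ _ ((c * (`|f x| + A)) ^+ 2)).
    exact/sqr_le_norm/glaplacian_wN_dist.
  rewrite exprMn [leRHS](_ : _ = c ^+ 2 * (2 * (f x ^+ 2 + A ^+ 2))); last by ring.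
  rewrite ler_wpM2l ?sqr_ge0//.
  rewrite -(real_normK (num_real (f x))).
  by have := sqr_ge0 (`|f x| - A); nra.
have mI := @measurable_I01 R.
rewrite RintegralZl// RintegralD// ?integral01_cst; [|exact: int01_cst].
have -> : (4 * K / N%:R) ^+ 2 = 2 * c ^+ 2 * 2 by rewrite /c; ring.
rewrite -[leRHS]mulrA ler_wpM2l ?(mulr_ge0 (ler0n _ 2) (sqr_ge0 c))//.
by have := integral_norm_sqr hf hf2; rewrite -/A; lra.
Qed.

Lemma opnorm_wN_le :
  (opnorm (fun f x => (glaplacian (wN w N) f x - glaplacian w f x)%R)
     <= (4 * K / N%:R)%:E)%E.
Proof.
apply: opnorm_le => [|f mf hf2 f1].
  by rewrite divr_ge0// mulr_ge0// ltW ?wK.1.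
have [g hg [gx gi]] := glaplacian_wN_sqr (int01_sqr_int01 mf hf2) hf2.
exists g => //; split=> //; apply: le_trans gi _.
by rewrite ler_piMr// sqr_ge0.
Qed.

Section FixedGraph.
Variables (rho t : R) (E : {set 'I_N * 'I_N}).
Hypotheses (rho01 : 0 < rho <= 1) (rho_t : rho <= t) (EU : E \subset upper_pairs N).
Let q (p : 'I_N * 'I_N) : R := rho * Pmat w N p.1 p.2.
Hypothesis Egood : good_event q t E.

(** Matrix of the step kernel [rho^-1 * what_N E - wN w N]. *)
Let M : 'M[R]_N := rho^-1 *: adjacency R E - Pmat w N.
Local Notation X := (centered_mx q E).
Local Notation P := (Pmat w N).

Let rho0 : 0 < rho. Proof. by case/andP: rho01. Qed.

Let M_entry k j : M k j = rho^-1 * X k j - (k == j)%:R * P k k.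
Proof.
have Esub p : p \in E -> (p.1 < p.2)%N by move=> /(fintype.subsetP EU); rewrite inE.
rewrite !mxE /centered_adjacency /centered.
have [->|kj] := eqVneq k j.
  have /negbTE -> : (j, j) \notin E by apply/negP => /Esub; rewrite ltnn.
  by rewrite /= !mulr0 mul1r !sub0r.
(* As [E] lies in [upper_pairs N], only the increasing one of the two pairs can belong to it. *)
have -> : ((k, j) \in E) || ((j, k) \in E) = (edge k j \in E).
  rewrite /edge; case: ltnP => kj'.
    by case: (boolP ((j, k) \in E)) => [/Esub|_]; rewrite ?orbF//= ltnNge ltnW.
  by case: (boolP ((k, j) \in E)) => [/Esub/=|//]; rewrite ltnNge kj'.
have -> : q (edge k j) = rho * w (k.+1%:R / N%:R) (j.+1%:R / N%:R).
  rewrite /q /edge; case: ltnP => _; rewrite !mxE//=.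
  by rewrite w_graphon.2//; exact: vertex_in.
by rewrite mul0r subr0 mulrBr mulKf ?gt_eqF.
Qed.

Let M_row k : \sum_j M k j = rho^-1 * row_sum q E k - P k k.
Proof.
under eq_bigr do rewrite M_entry.
rewrite sumrB -mulr_sumr; congr (_ * _ - _).
  by apply: eq_bigr => j _; rewrite mxE.
by rewrite (bigD1 k)//= eqxx mul1r big1 ?addr0// => j /negbTE; rewrite eq_sym => ->; rewrite mul0r.
Qed.

Let t0 : 0 < t. Proof. exact: lt_le_trans rho_t. Qed.

(** The row sum of [X] gives [t / rho] and the diagonal entry at most [1 <= t / rho]. *)
Let M_degree k : `|(\sum_j M k j) / N%:R| <= 2 * t / (rho * N%:R).
Proof.
rewrite M_row normrM (ger0_norm (_ : 0 <= N%:R^-1)) ?invr_ge0//.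
rewrite invfM mulrA ler_pM2r ?invr_gt0//.
apply: le_trans (ler_normB _ _) _.
rewrite normrM (ger0_norm (_ : 0 <= rho^-1)) ?invr_ge0 ?(ltW rho0)//.
have /andP[P0 P1] : 0 <= P k k <= 1 by rewrite mxE; apply: w_graphon.1; exact: vertex_in.
rewrite (ger0_norm P0) ler_pdivlMr// mulrDl mulrAC mulVf ?gt_eqF// mul1r.
have rowk : `|row_sum q E k| <= t := Egood.2 k.
have Prho : P k k * rho <= rho by rewrite ler_piMl ?(ltW rho0).
by move: rho_t; lra.
Qed.

(** The diagonal entries cancel and leave [rho^-1 (D - X) a]; then [|(D - X) a|^2 <= 2 |D a|^2 + 2
    |X a|^2 <= 4 t^2 |a|^2]. *)
Let M_laplacian (a : 'cV[R]_N) :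
  \sum_k ((\sum_j M k j) * a k 0 - \sum_j M k j * a j 0) ^+ 2
    <= (2 * t / (rho * N%:R) * N%:R) ^+ 2 * sqnorm a.
Proof.
have termE k : (\sum_j M k j) * a k 0 - \sum_j M k j * a j 0
    = rho^-1 * (row_sum q E k * a k 0 - (X *m a) k 0).
  rewrite M_row [(X *m a) k 0]mxE.
  have -> : \sum_j M k j * a j 0 = rho^-1 * \sum_j X k j * a j 0 - P k k * a k 0.
    under eq_bigr do rewrite M_entry mulrBl.
    rewrite sumrB mulr_sumr; congr (_ - _).
      by apply: eq_bigr => j _; rewrite mulrA.
    rewrite (bigD1 k)//= eqxx mul1r big1 ?addr0// => j /negbTE.
    by rewrite eq_sym => ->; rewrite !mul0r.
  by ring.
apply: (@le_trans _ _ (\sum_k rho^-1 ^+ 2 * (2 * (t ^+ 2 * a k 0 ^+ 2)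
    + 2 * (X *m a) k 0 ^+ 2))).
  apply: ler_sum => k _; rewrite termE exprMn ler_wpM2l ?sqr_ge0//.
  have : (row_sum q E k) ^+ 2 * a k 0 ^+ 2 <= t ^+ 2 * a k 0 ^+ 2.
    by rewrite ler_wpM2r ?sqr_ge0//; exact/sqr_le_norm/Egood.2.
  by have := sqr_ge0 (row_sum q E k * a k 0 + (X *m a) k 0); nra.
rewrite -mulr_sumr big_split/= -!mulr_sumr -/(sqnorm a) -/(sqnorm (X *m a)).
have -> : 2 * t / (rho * N%:R) * N%:R = rho^-1 * (2 * t).
  by field; rewrite !gt_eqF.
rewrite [in leRHS]exprMn -[leRHS]mulrA ler_wpM2l ?sqr_ge0//.
by have := Egood.1 a; nra.
Qed.

Lemma good_conc_event : conc_event w rho (2 * t / (rho * N%:R) + 4 * K / N%:R) N E.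
Proof.
set al := 2 * t / _; set be := 4 * K / _.
have al0 : 0 < al by rewrite /al divr_gt0 ?mulr_gt0.
have be0 : 0 < be by rewrite /be divr_gt0 ?mulr_gt0 ?wK.1.
apply: opnorm_le => [|f mf hf2 f1]; first by rewrite ltW// addr_gt0.
have hf := int01_sqr_int01 mf hf2.
have [g1 hg1 [g1x g1i]] := step_sqr_le N_gt0 hf hf2 (ltW al0) M_degree M_laplacian.
have [g2 hg2 [g2x g2i]] := glaplacian_wN_sqr hf hf2.
(* Minkowski's inequality on majorants: these weights make [(u + v)^2] integrate to at most
   [(al + be)^2]. *)
exists (fun x => (1 + be / al) * g1 x + (1 + al / be) * g2 x).
  by apply: int01D; exact: int01Z.
have r1 : 0 <= be / al by rewrite divr_ge0 ?ltW.
have r2 : 0 <= al / be by rewrite divr_ge0 ?ltW.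
split=> [x x01|].
  have [k xk] := cell_exists N_gt0 x01.
  have -> : rho^-1 * glaplacian (what_N E) f x - glaplacian w f x =
      glaplacian (stepgraphon M) f x + (glaplacian (wN w N) f x - glaplacian w f x).
    rewrite addrA; congr (_ - _).
    rewrite /what_N /wN !(glaplacian_step N_gt0 _ hf xk).
    have Mk j : M k j = rho^-1 * adjacency R E k j - P k j.
      by rewrite !mxE.
    rewrite (eq_bigr _ (fun j _ => Mk j)) sumrB -mulr_sumr.
    rewrite [X in _ = _ - X + _](eq_bigr (fun j => rho^-1 * (adjacency R E k j *
      integral (fun y => (y \in cell R N j)%:R * f y)) - P k j *
      integral (fun y => (y \in cell R N j)%:R * f y))); last first.
      by move=> j _; rewrite Mk mulrBl mulrA.
    by rewrite sumrB -mulr_sumr; ring.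
  move: (g1x x x01) (g2x x x01).
  set u := glaplacian (stepgraphon M) f x; set v := _ - _ => h1 h2.
  apply: (@le_trans _ _ ((1 + be / al) * u ^+ 2 + (1 + al / be) * v ^+ 2)).
    rewrite -subr_ge0.
    have -> : (1 + be / al) * u ^+ 2 + (1 + al / be) * v ^+ 2 - (u + v) ^+ 2 =
      (al * be)^-1 * (be * u - al * v) ^+ 2 by field; rewrite !gt_eqF.
    by rewrite mulr_ge0 ?sqr_ge0// invr_ge0 mulr_ge0 ?ltW.
  by apply: lerD; rewrite ler_wpM2l// addr_ge0.
have mI := @measurable_I01 R.
rewrite RintegralD//; [|exact: int01Z|exact: int01Z].
rewrite !RintegralZl//.
have i0 : 0 <= integral (fun x => f x ^+ 2).
  by apply: Rintegral_ge0 => x _; rewrite sqr_ge0.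
have {}g1i : integral g1 <= al ^+ 2 by apply: le_trans g1i _; rewrite ler_piMr ?sqr_ge0.
have {}g2i : integral g2 <= be ^+ 2 by apply: le_trans g2i _; rewrite ler_piMr ?sqr_ge0.
have -> : (al + be) ^+ 2 = (1 + be / al) * al ^+ 2 + (1 + al / be) * be ^+ 2.
  by field; rewrite !gt_eqF.
by apply: lerD; rewrite ler_wpM2l// addr_ge0.
Qed.

End FixedGraph.

(** The value [eps N = 1] is allowed because [eps_gamma gamma 1 = 1] for [gamma > 1]. *)
Lemma conc_probability (tau : R) (eps : nat -> R) : 0 <= tau ->
  0 < eps N <= 1 -> N1cond w K tau eps N ->
  1 - eps N <= prob_graph w (rhoN tau N) N
    (conc_event w (rhoN tau N)
      (4 * Num.sqrt (ln (4 * N%:R / eps N) / (rhoN tau N * N%:R)) + 4 * K / N%:R) N).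
Proof.
move=> tau0 /andP[e0 e1]; rewrite /N1cond.
set rho := rhoN tau N; set L := ln _ => cond.
have N1 : 1 <= N%:R :> R by rewrite ler1n.
have rho0 : 0 < rho by rewrite powR_gt0.
have rho1 : rho <= 1.
  by rewrite /rho /rhoN -[leRHS](powRr0 N%:R) ler_powR// oppr_le0.
have arg4 : 4 <= 4 * N%:R / eps N.
  by rewrite ler_pdivlMr//; nra.
(* This gives [t^2 = 4 s L >= s >= rho >= rho^2] below, hence [rho <= t]. *)
have L14 : 1 / 4 <= L.
  rewrite /L -ler_expR lnK ?posrE; last by rewrite (lt_le_trans _ arg4).
  apply: le_trans arg4; apply: le_trans (expR_quadratic_le _) _; last by lra.
  by lra.
set s := rho * N%:R in cond *.
have s0 : 0 < s by rewrite mulr_gt0.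
(* The degree condition and [dMAX w <= 1] give [4 L / (9 s) <= 1]. *)
have Ls : L <= 9 / 4 * s.
  have : 4 * L / (9 * s) <= 1.
    have := dMAX_le1; move: cond; rewrite -[9 * rho * _]mulrA -/s.
    have : 0 <= 2 * K / N%:R by rewrite divr_ge0// mulr_ge0// ltW ?wK.1.
    by lra.
  by rewrite ler_pdivrMr; lra.
set y := Num.sqrt (L / s).
have Ls0 : 0 <= L / s by rewrite divr_ge0 ?ltW//; lra.
have y0 : 0 <= y by rewrite sqrtr_ge0.
have y2 : y ^+ 2 = L / s by rewrite sqr_sqrtr.
have sy2 : s * y ^+ 2 = L by rewrite y2 mulrC divfK ?gt_eqF.
have y32 : y <= 3 / 2.
  have : y ^+ 2 <= 9 / 4 by rewrite y2 ler_pdivrMr//; lra.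
  by nra.
pose q (p : 'I_N * 'I_N) : R := rho * Pmat w N p.1 p.2.
have Pij (p : 'I_N * 'I_N) : 0 <= Pmat w N p.1 p.2 <= 1.
  by rewrite mxE; apply: w_graphon.1; exact: vertex_in.
have q0 p : p \in upper_pairs N -> 0 <= q p.
  by move=> _; have /andP[? ?] := Pij p; rewrite mulr_ge0// ltW.
have qrho p : p \in upper_pairs N -> q p <= rho.
  by move=> _; have /andP[? ?] := Pij p; rewrite ler_piMr// ltW.
have rho01 : 0 <= rho <= 1 by rewrite ltW.
have q01 p : p \in upper_pairs N -> 0 <= q p <= 1.
  by move=> pU; rewrite q0//= (le_trans (qrho p pU)).
set t := 2 * (N%:R * rho) * y.
have rho_t : rho <= t.
  have sN : s = N%:R * rho by rewrite mulrC.
  have rs : rho <= s by rewrite /s ler_peMr// ltW.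
  have t0 : 0 <= t by rewrite /t -sN mulr_ge0// mulr_ge0// ltW.
  have t2 : t ^+ 2 = 4 * s * L by rewrite -sy2 /t -sN; ring.
  have : rho ^+ 2 <= t ^+ 2 by rewrite t2; nra.
  by rewrite ler_pXn2r ?nnegrE// ltW.
have y01 : 0 <= y <= 3 / 2 by rewrite y0.
apply: le_trans (le_trans (good_event_expect rho01 q0 qrho y01) _); last first.
  apply: le_expect => // E EU.
  case: asboolP => [good|_]; last by rewrite ler0n.
  suff -> : `[< conc_event w rho (4 * y + 4 * K / N%:R) N E >] by [].
  apply/asboolP.
  have -> : 4 * y = 2 * t / (rho * N%:R) by rewrite /t; field; rewrite !gt_eqF.
  by apply: good_conc_event => //; rewrite rho0.
have -> : N%:R * rho * y ^+ 2 = L by rewrite -sy2 /s; ring.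
rewrite expRN lnK ?posrE; last by rewrite (lt_le_trans _ arg4).
(* The failure probability is [4 N e^(-L) = eps N]. *)
by rewrite lerD2l lerN2 invf_div mulrCA divff ?mulr1 ?gt_eqF// mulr_gt0.
Qed.

End FixedN.

End Concentration.

Theorem mainTheorem8 (R : realType) (w : R -> R -> R) (K : R) :
  is_graphon w -> lipschitzA1 w K ->
  (forall N : nat, (0 < N)%N ->
     (opnorm (fun f x => (glaplacian (wN w N) f x - glaplacian w f x)%R)
        <= (4 * K / N%:R)%:E)%E)
  /\
  (forall tau : R, 0 <= tau < 1 ->
     (forall eps : R, 0 < eps < 1 ->
        forall N : nat, (0 < N)%N -> geN1 w K tau (fun _ => eps) N ->
          prob_graph w (rhoN tau N) N
            (conc_event w (rhoN tau N)
               (4 * Num.sqrt (ln (4 * N%:R / eps) / (rhoN tau N * N%:R))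
                + 4 * K / N%:R) N)
          >= 1 - eps)
     /\
     (forall gamma : R, 1 < gamma ->
        forall N : nat, (0 < N)%N -> geN1 w K tau (eps_gamma gamma) N ->
          prob_graph w (rhoN tau N) N
            (conc_event w (rhoN tau N)
               (4 * Num.sqrt (ln (4 * N%:R / eps_gamma gamma N)
                               / (rhoN tau N * N%:R))
                + 4 * K / N%:R) N)
          >= 1 - eps_gamma gamma N)).
Proof.
move=> w_graphon wK; split=> [N N_gt0|tau /andP[tau0 _]].
  exact: opnorm_wN_le.
split=> [eps /andP[e0 e1]|gamma _] N N_gt0 [n nP nN].
  apply: (@conc_probability R w K w_graphon wK N N_gt0 tau (fun=> eps)) => //.
    by rewrite e0 ltW.
  exact: nP.
apply: (@conc_probability R w K w_graphon wK N N_gt0 tau (eps_gamma gamma)) => //.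
  by rewrite expR_gt0 -expR0 ler_expR oppr_le0 powR_ge0.
exact: nP.
Qed.
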